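(* Let $d\ge2$. There exists $\beta_0=\beta_0(d)$ such that for every $\beta\ge\beta_0$ and every $s>0$ the following holds. Let $(h_x)_x$ be i.i.d. centered Gaussian external fields with variance $s^2$ (not depending on $n$). Then with $\mathbb{P}_h$-probability tending to $1$ as $n\to\infty$, the mixing time of the continuous-time Glauber dynamics for the RFIM on $\Lambda_n=[-n,n]^d\cap\mathbb{Z}^d$ at inverse temperature $\beta$ is at least $\exp\big((\log n)^{(d-1)/(4d)}\big)$.
   Context: $\Lambda_n$ carries nearest-neighbour adjacency. Given $h$, the random field Ising model (RFIM) on $\Lambda_n$ is $$\mu_{\Lambda_n}(\sigma)\propto\exp\Big(\beta\sum_{(u,v)\in E(\Lambda_n)}\sigma_u\sigma_v+\sum_{u\in\Lambda_n}h_u\sigma_u\Big),\qquad\sigma\in\{-1,+1\}^{\Lambda_n}.$$ $\mathbb{P}_h$ is the law of $h$. Continuous-time Glauber dynamics $(X_t)$: each vertex has an independent rate-1 Poisson clock, at whose rings its spin is resampled from the conditional law under $\mu_{\Lambda_n}$ given all other spins. The mixing time is $\inf\{t\ge0:\max_\sigma d_{\mathrm{TV}}(\mathbb{P}(X_t\in\cdot\mid X_0=\sigma),\mu_{\Lambda_n})\le1/4\}$, with $d_{\mathrm{TV}}$ the total variation distance. *)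

(* Defs.v *)
From HB Require Import structures.
From mathcomp Require Import all_boot all_order all_algebra.
From mathcomp Require Import all_classical all_reals all_analysis.

Set Implicit Arguments.
Unset Strict Implicit.
Unset Printing Implicit Defensive.

Import Order.TTheory GRing.Theory Num.Theory.
Import numFieldNormedType.Exports.

Local Open Scope classical_set_scope.
Local Open Scope ring_scope.

Definition rv_events d d' (T : measurableType d) (T' : measurableType d')
    (X : T -> T') : set (set T) :=
  [set X @^-1` B | B in measurable].

Definition mutually_independent d (T : measurableType d) (R : realType)
    (P : probability T R) (I : eqType) (E : I -> set (set T)) : Prop :=
  forall (J : seq I) (A : I -> set T), uniq J ->
    (forall i, i \in J -> E i (A i)) ->
    P (\bigcap_(i in [set` J]) A i) = (\prod_(i <- J) P (A i))%E.

Definition iid_centered_gaussian d (T : measurableType d) (R : realType)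
    (P : probability T R) (I : eqType) (s : R) (h : I -> {RV P >-> R}) : Prop :=
  mutually_independent P (fun i => rv_events (h i)) /\
  (forall (i : I) (B : set R), measurable B ->
     distribution P (h i) B = normal_prob 0 s B).

(* A configuration is boolean-valued; [true] encodes the spin +1 and [false]
   the spin -1. *)
Notation config V := {ffun V -> bool}.

Definition spin (R : realType) (b : bool) : R := if b then 1 else -1.

Section RFIM.
Variables (R : realType) (V : finType) (e : rel V) (beta : R) (h : V -> R).

(* For a symmetric [e] the double sum counts each unordered edge twice. *)
Definition rfim_exponent (s : config V) : R :=
  beta * (2^-1 * \sum_(u : V) \sum_(v : V | e u v) spin R (s u) * spin R (s v))
  + \sum_(u : V) h u * spin R (s u).

Definition rfim (s : config V) : R :=
  expR (rfim_exponent s) / \sum_(r : config V) expR (rfim_exponent r).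

Definition set_spin (s : config V) (v : V) (b : bool) : config V :=
  [ffun u => if u == v then b else s u].

Definition cond_plus (s : config V) (v : V) : R :=
  rfim (set_spin s v true) /
  (rfim (set_spin s v true) + rfim (set_spin s v false)).

(* [x] is a uniform variable on [0, 1]: the new spin at [v] is +1 with
   probability [cond_plus s v]. *)
Definition resample (s : config V) (v : V) (x : R) : config V :=
  set_spin s v (x <= cond_plus s v).

(* [gd_clock v t] is the number of rings of the clock at [v] during (0, t], and
   [gd_unif v k] is the randomness used at the ring of [v] preceded by exactly
   [k] rings of [v].  [gd_state s t] is the state at time [t] of the dynamics
   started from [s]; [gd_no_ring] and [gd_one_ring] determine it on every path
   without simultaneous rings, i.e. almost surely. *)
Record glauber_dynamics := GlauberDynamics {
  gd_disp : measure_display;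
  gd_space : measurableType gd_disp;
  gd_prob : probability gd_space R;
  gd_clock : V -> R -> {RV gd_prob >-> nat};
  gd_unif : V -> nat -> {RV gd_prob >-> R};
  gd_state : config V -> R -> gd_space -> config V;
  gd_clock0 : forall v w, gd_clock v 0 w = 0%N;
  gd_clock_nondecreasing : forall v w (a b : R), 0 <= a -> a <= b ->
    (gd_clock v a w <= gd_clock v b w)%N;
  gd_clock_right_continuous : forall v w (a : R), 0 <= a ->
    \forall b \near a^'+, gd_clock v b w = gd_clock v a w;
  gd_clock_poisson : forall v (a b : R) (k : nat), 0 <= a -> a < b ->
    gd_prob [set w | (gd_clock v b w - gd_clock v a w)%N = k] =
    (poisson_pmf (b - a) k)%:E;
  gd_unif_uniform : forall v k (B : set R), measurable B ->
    distribution gd_prob (gd_unif v k) B = uniform_prob (@ltr01 R) B;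
  (* independent increments of each clock, and joint independence of all the
     clocks and all the uniform variables *)
  gd_independent : forall t : nat -> R, 0 <= t 0%N -> nondecreasing_seq t ->
    mutually_independent gd_prob (fun i : (V * nat) + (V * nat) =>
      match i with
      | inl (v, j) => rv_events
          (fun w => (gd_clock v (t j.+1) w - gd_clock v (t j) w)%N)
      | inr (v, k) => rv_events (gd_unif v k)
      end);
  gd_measurable : forall s (a : R) r, 0 <= a ->
    measurable [set w | gd_state s a w = r];
  gd_init : forall s w, gd_state s 0 w = s;
  gd_no_ring : forall s w (a b : R), 0 <= a -> a <= b ->
    (forall v, gd_clock v b w = gd_clock v a w) ->
    gd_state s b w = gd_state s a w;
  gd_one_ring : forall s w (a b : R) v, 0 <= a -> a <= b ->
    gd_clock v b w = (gd_clock v a w).+1 ->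
    (forall u, u != v -> gd_clock u b w = gd_clock u a w) ->
    gd_state s b w =
      resample (gd_state s a w) v (gd_unif v (gd_clock v a w) w)
}.

Definition gd_law (G : glauber_dynamics) (s : config V) (t : R) (r : config V)
    : R :=
  fine (gd_prob G [set w | @gd_state G s t w = r]).

Definition dTV (p q : config V -> R) : R :=
  2^-1 * \sum_(r : config V) `|p r - q r|.

Definition mixing_time (G : glauber_dynamics) : \bar R :=
  ereal_inf [set t%:E | t in [set t : R | 0 <= t /\
    \big[Num.max/0]_(s : config V) dTV (gd_law G s t) rfim <= 4^-1]].

End RFIM.

Definition lattice (d : nat) := {ffun 'I_d -> int}.

Definition box (d n : nat) := {ffun 'I_d -> 'I_(n.*2.+1)}.

(* The coordinate [k] in {0, ..., 2n} of a box element stands for [k - n]. *)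
Definition site (d n : nat) (x : box d n) : lattice d :=
  [ffun i => (x i : nat)%:Z - n%:Z].

Definition box_adj (d n : nat) : rel (box d n) :=
  fun x y => \sum_(i < d) `|site x i - site y i| == 1.

(* Main.v *)
Require Import Defs.
From HB Require Import structures.
From mathcomp Require Import all_boot all_order all_algebra.
From mathcomp Require Import zify ring lra.

Set Implicit Arguments.
Unset Strict Implicit.
Unset Printing Implicit Defensive.

Import Order.TTheory GRing.Theory Num.Theory.

(** With high probability the disorder contains a metastable trap.  Fix a flat square
    Q of side L, of order (log n)^a with a = (d-1)/(4d), in a coordinate plane
    of the box, and ask that
    - the field at each neighbour of Q outside Q exceeds a constant times L, so
      that these neighbours stay frozen at +1 for a time exponential in L;
    - the field at each site of Q cancels, up to an error of order 1/L^2, the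
      force exerted by its frozen neighbours outside Q.
    The first condition costs L^2 events of probability exp(- C L^2), the
    second one L^2 events of probability of order 1/L^2: together a
    probability exp(- C L^4), and L^4 is of order (log n)^((d-1)/d) = o(log n).
    A line of the box has room for n^(1-o(1)) disjoint translates of Q, far more
    than the inverse of this probability, so one of these independent attempts
    succeeds with probability tending to 1 ([prb_some_hit],
    [slow_mixing_prob]).  A planar square is enough in every dimension, and
    this is what the exponent a < 1/4 leaves room for.

    On such a square the model is a two-dimensional Ising model at low
    temperature in a negligible field, with two phases.  A configuration of
    the square is in phase c if each connected contour has length at most k, a
    small fraction of L, and if the value outside all the contours is c
    ([in_phase]).  If moreover every contour is shorter than a smaller
    threshold m, one spin flip cannot leave the phase ([in_phase_flip]): it
    merges boundedly many contours, and the region where the sign of the phase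
    could change has size O(k^2) < L^2.  Hence leaving a phase requires a
    contour longer than m or the flip of a frozen spin.  Erasing a contour g
    multiplies the weight by exp(2 beta |g| - O(1)) and stays in the phase,
    so contours longer than m have conditional probability
    O(L^2) exp(- 2 m) once beta beats their entropy ([peierls]).  The entropy
    bound [sum_is_cluster_le1] is a percolation argument.  Any beta >= 10 is
    enough, whatever the dimension.

    The two phases are disjoint, so one of them has mass at most 1/2, and a
    set of mass at most 1/2 that the dynamics leaves at rate at most phi forces
    the mixing time to be at least 1 / (4 phi) ([law_bottleneck],
    [trap_mixing_time]).

    Two facts on the dynamics are needed to make sense of this.  The law of
    the graphically constructed process is a limit of explicit Euler schemes
    with substochastic transition kernels ([gd_law_ge]): the schemes are
    dominated by the law and lose a mass that tends to 0 with the mesh, so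
    stationarity, contraction of the total variation distance and bounds on
    the exit probability pass to the limit.  The event that the mixing time is
    large is measurable in the disorder ([measurable_mixing_time_ge]), since
    the Euler schemes are measurable functions of the field and the distance
    to equilibrium is nonincreasing in time. *)

(** * Clusters of a finite set in a symmetric relation *)

Section Clusters.
Variables (E : finType) (a : rel E).
Hypothesis a_sym : symmetric a.
Implicit Types (A B T g : {set E}).

Definition edge_within A : rel E := fun x y => [&& x \in A, y \in A & a x y].
Definition cluster_of A x : {set E} := [set y | connect (edge_within A) x y].
Definition clusters A : {set {set E}} := [set cluster_of A x | x in A].
Definition halo A : {set E} := [set z | (z \in A) || [exists y in A, a y z]].

Lemma edge_within_csym A : connect_sym (edge_within A).
Proof.
apply: sym_connect_sym => x y; rewrite /edge_within a_sym.
by case: (x \in A); case: (y \in A).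
Qed.

Lemma halo_self A : A \subset halo A.
Proof. by apply/subsetP => x xA; rewrite inE xA. Qed.

Lemma halo_adj A x y : x \in A -> a x y -> y \in halo A.
Proof.
by move=> xA axy; rewrite inE; apply/orP; right; apply/existsP; exists x; rewrite xA.
Qed.

Lemma haloP A z : z \in halo A -> z \in A \/ exists2 y, y \in A & a y z.
Proof.
rewrite inE => /orP[|/existsP[y /andP[yA ayz]]]; first by left.
by right; exists y.
Qed.

Lemma cluster_of_self A x : x \in cluster_of A x.
Proof. by rewrite inE connect0. Qed.

Lemma cluster_of_step A x y z : x \in A -> y \in cluster_of A x -> y \in A ->
  z \in A -> a y z -> z \in cluster_of A x.
Proof.
move=> xA; rewrite !inE => cxy yA zA ayz; apply: connect_trans cxy _.
by apply: connect1; rewrite /edge_within yA zA.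
Qed.

Lemma cluster_of_min A (Z : {set E}) x : x \in Z ->
  (forall y z, y \in Z -> y \in A -> z \in A -> a y z -> z \in Z) ->
  cluster_of A x \subset Z.
Proof.
move=> xZ closed; apply/subsetP => y; rewrite inE => /connectP[p pth ->].
elim: p x xZ pth => [|z p IH] x xZ //= /andP[/and3P[xA zA axz] pth].
by apply: IH pth; apply: closed axz.
Qed.

Lemma cluster_of_sub A x : x \in A -> cluster_of A x \subset A.
Proof. by move=> xA; apply: cluster_of_min => //. Qed.

Lemma cluster_of_eq A x y : y \in cluster_of A x -> cluster_of A y = cluster_of A x.
Proof.
rewrite inE => cxy; apply/setP => z; rewrite !inE.
by rewrite (same_connect (edge_within_csym A) cxy).
Qed.

Lemma mem_clusters A x : x \in A -> cluster_of A x \in clusters A.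
Proof. by move=> xA; apply/imsetP; exists x. Qed.

Lemma clusters_cluster_of A g x : g \in clusters A -> x \in g -> cluster_of A x = g.
Proof. by move=> /imsetP[y yA ->]; exact: cluster_of_eq. Qed.

Lemma clusters_sub A g : g \in clusters A -> g \subset A.
Proof. by move=> /imsetP[x xA ->]; exact: cluster_of_sub. Qed.

Lemma clusters_n0 A g : g \in clusters A -> exists x, x \in g.
Proof. by move=> /imsetP[x xA ->]; exists x; exact: cluster_of_self. Qed.

Lemma clusters_closed A g y z : g \in clusters A -> y \in g -> z \in A -> a y z ->
  z \in g.
Proof.
move=> gA yg zA ayz; have yA := subsetP (clusters_sub gA) _ yg.
rewrite -(clusters_cluster_of gA yg).
exact: (cluster_of_step yA (cluster_of_self _ _) yA zA ayz).
Qed.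

Lemma clusters_halo A g : g \in clusters A -> A :&: halo g = g.
Proof.
move=> gA; apply/setP => z; rewrite inE; apply/andP/idP.
  by case=> zA /haloP[//|[y yg ayz]]; exact: (clusters_closed gA yg).
by move=> zg; rewrite (subsetP (halo_self g)) // (subsetP (clusters_sub gA)).
Qed.

Lemma clusters_local A B g : g \in clusters A -> B :&: halo g = g -> g \in clusters B.
Proof.
move=> gA gB; have [x xg] := clusters_n0 gA.
have xA := subsetP (clusters_sub gA) _ xg.
have inB y : y \in g -> y \in B by rewrite -{1}gB inE => /andP[].
suff -> : g = cluster_of B x by apply: mem_clusters; exact: inB.
apply/eqP; rewrite eqEsubset; apply/andP; split.
  rewrite -{1}(clusters_cluster_of gA xg).
  suff /subset_trans : cluster_of A x \subset cluster_of B x :&: g.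
    by apply; exact: subsetIl.
  apply: cluster_of_min; first by rewrite inE cluster_of_self.
  move=> y z /setIP[yB yg] yA zA ayz.
  have zg : z \in g by exact: (clusters_closed gA yg).
  by rewrite inE zg andbT; apply: cluster_of_step (ayz) => //; exact: inB.
apply: cluster_of_min => // y z yg yB zB ayz.
by rewrite -gB inE zB; exact: halo_adj ayz.
Qed.

Lemma clusters_remove A g : g \in clusters A ->
  clusters (A :\: g) = clusters A :\ g.
Proof.
move=> gA; apply/setP => k; rewrite in_setD1; apply/idP/andP.
  move=> kB; have [x xk] := clusters_n0 kB; split.
    by apply/eqP => kg; have := subsetP (clusters_sub kB) _ xk; rewrite inE -kg xk.
  apply: (clusters_local kB).
  apply/setP => z; rewrite in_setI; apply/andP/idP => [[zA /haloP[//|[y yk ayz]]]|zk].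
    have := subsetP (clusters_sub kB) _ yk; rewrite inE => /andP[yg yA].
    apply: (clusters_closed kB yk _ ayz); rewrite inE zA andbT.
    by apply: contra yg => zg; apply: (clusters_closed gA zg) => //; rewrite a_sym.
  have := subsetP (clusters_sub kB) _ zk; rewrite inE => /andP[_ ->].
  by rewrite (subsetP (halo_self k)).
move=> [kg kA]; apply: (clusters_local kA).
have disj z : z \in k -> z \notin g.
  move=> zk; apply: contra kg => zg.
  by rewrite -(clusters_cluster_of kA zk) (clusters_cluster_of gA zg).
apply/setP => z; rewrite in_setI in_setD -andbA -in_setI clusters_halo //.
by have [zk|] := boolP (z \in k); rewrite ?andbF // disj.
Qed.

(** How the clusters change when a set is modified inside T: those away from T
    are unchanged, and the new ones are glued from T and from the clusters
    that meet the halo of T. *)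
Section Perturbation.
Variables A B T : {set E}.
Hypothesis agree : forall x, x \notin T -> (x \in A) = (x \in B).

Lemma clusters_far g : g \in clusters B -> g :&: halo T = set0 -> g \in clusters A.
Proof.
move=> gB g0.
have farg z : z \in halo g -> z \notin T.
  move=> /haloP[zg|[y yg ayz]]; apply/negP => zT.
    by have := in_set0 z; rewrite -g0 inE zg (subsetP (halo_self T)).
  by have := in_set0 y; rewrite -g0 inE yg (halo_adj zT) // a_sym.
apply: (clusters_local gB); rewrite -[RHS](clusters_halo gB).
apply/setP => z; rewrite !(in_setI) andbC [RHS]andbC.
by have [/farg/agree -> |] := boolP (z \in halo g).
Qed.

Lemma clusters_near_sub g f : g \in clusters B -> f \in g -> f \in halo T ->
  g \subset T :|: \bigcup_(k in halo T :&: A) cluster_of A k.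
Proof.
move=> gB fg fT; rewrite -(clusters_cluster_of gB fg).
have fB := subsetP (clusters_sub gB) _ fg.
have stepA z : z \in halo T -> z \in B ->
  z \in T :|: \bigcup_(k in halo T :&: A) cluster_of A k.
  move=> zh zB; rewrite inE; have [//|zT] := boolP (z \in T).
  apply/bigcupP; exists z; last exact: cluster_of_self.
  by rewrite inE zh agree.
apply: cluster_of_min => [|y z]; first exact: stepA.
rewrite inE => /orP[yT|/bigcupP[k kT yk]] yB zB ayz.
  by apply: stepA => //; exact: halo_adj ayz.
have [zT|zT] := boolP (z \in T); first by rewrite inE zT.
rewrite inE; apply/orP; right; apply/bigcupP; exists k => //.
move: kT; rewrite inE => /andP[_ kA].
apply: (cluster_of_step kA yk) => //; last by rewrite agree.
exact: (subsetP (cluster_of_sub kA)).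
Qed.

Lemma clusters_near_card g f (m : nat) : g \in clusters B -> f \in g ->
  f \in halo T -> (forall k, k \in clusters A -> #|k| <= m) ->
  #|g| <= #|T| + #|halo T| * m.
Proof.
move=> gB fg fT small.
apply: leq_trans (subset_leq_card (clusters_near_sub gB fg fT)) _.
apply: leq_trans (leq_card_setU _ _) _; rewrite leq_add2l.
apply: (@leq_trans (\sum_(k in halo T :&: A) #|cluster_of A k|)).
  elim/big_rec2: _ => [|k s U _ IH]; first by rewrite cards0.
  by apply: leq_trans (leq_card_setU _ _) _; rewrite leq_add2l.
apply: (@leq_trans (\sum_(k in halo T :&: A) m)).
  by apply: leq_sum => k /setIP[_ kA]; apply: small; exact: mem_clusters.
by rewrite sum_nat_const leq_mul2r subset_leq_card ?orbT ?subsetIl.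
Qed.

End Perturbation.

Lemma card_clusters_meet A S :
  #|[set g in clusters A | g :&: S != set0]| <= #|S|.
Proof.
apply: leq_trans (leq_imset_card (cluster_of A) S); apply: subset_leq_card.
apply/subsetP => g; rewrite inE => /andP[gA /set0Pn[f /setIP[fg fS]]].
by apply/imsetP; exists f => //; rewrite (clusters_cluster_of gA fg).
Qed.

(** Clusters partition the set; written as a sum modulo 2 because contours are
    superposed modulo 2. *)
Lemma addb_clusters A x : \big[addb/false]_(g in clusters A) (x \in g) = (x \in A).
Proof.
have [xA|xA] := boolP (x \in A); last first.
  rewrite big1 // => g gA; apply/negbTE; apply: contra xA.
  exact: (subsetP (clusters_sub gA)).
rewrite (bigD1 (cluster_of A x)) /=; last exact: mem_clusters.
rewrite cluster_of_self big1 // => g /andP[gA ne].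
by apply/negbTE; apply: contra ne => xg; rewrite (clusters_cluster_of gA xg).
Qed.

Definition is_cluster g := g \in clusters g.

Lemma clusters_is_cluster A g : g \in clusters A -> is_cluster g.
Proof.
move=> gA; apply: (clusters_local gA); apply/setIidPl; exact: halo_self.
Qed.

Lemma card_halo_le g K : (forall y, #|halo [set y]| <= K) -> #|halo g| <= K * #|g|.
Proof.
move=> degK.
have sub : halo g \subset \bigcup_(y in g) halo [set y].
  apply/subsetP => z /haloP[zg|[y yg ayz]]; apply/bigcupP.
    by exists z => //; rewrite (subsetP (halo_self _)) ?set11.
  by exists y => //; rewrite (halo_adj (set11 y)).
apply: leq_trans (subset_leq_card sub) _.
apply: (@leq_trans (\sum_(y in g) K)); last by rewrite sum_nat_const mulnC.
apply: (@leq_trans (\sum_(y in g) #|halo [set y]|)); last exact: leq_sum.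
elim/big_rec2: _ => [|k s U _ IH]; first by rewrite cards0.
by apply: leq_trans (leq_card_setU _ _) _; rewrite leq_add2l.
Qed.

Lemma card_fixed_trace (S g : {set E}) : g \subset S ->
  2 ^ (#|E| - #|S|) <= #|[set w : {set E} | w :&: S == g]|.
Proof.
move=> gS.
have -> : #|E| - #|S| = #|~: S| by have := cardsC S; lia.
rewrite -card_powerset.
have inj : {in powerset (~: S) &, injective (fun w => w :|: g)}.
  move=> u v; rewrite !inE => uS vS /setP uv; apply/setP => x.
  have := uv x; rewrite !inE.
  have [xS|xS] := boolP (x \in S).
    have nx (w : {set E}) : w \subset ~: S -> (x \in w) = false.
      by move=> /subsetP/(_ x); rewrite inE xS => H; apply/negP => /H.
    by rewrite (nx u uS) (nx v vS).
  have /negbTE -> : x \notin g by apply: contra xS; exact: (subsetP gS).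
  by rewrite !orbF.
rewrite -(card_in_imset inj); apply: subset_leq_card.
apply/subsetP => _ /imsetP[w + ->]; rewrite !inE => wS.
rewrite setIUl (setIidPl gS).
suff -> : w :&: S = set0 by rewrite set0U.
by apply/eqP; rewrite setI_eq0 disjoints_subset.
Qed.

Local Open Scope ring_scope.

(** Entropy bound for connected sets containing e, by percolation with density
    1/2: in a uniform random subset w of E, the event that w agrees with g on
    the halo of g forces the cluster of e to be g, so these events are disjoint
    for different g, and each has probability at least 2^(- K |g|). *)
Lemma sum_is_cluster_le1 (R : realFieldType) (K : nat) (e : E) :
  (forall y, #|halo [set y]| <= K)%N ->
  \sum_(g : {set E} | is_cluster g && (e \in g)) (2^-1 : R) ^+ (K * #|g|) <= 1.
Proof.
move=> degK.
have two0 : (0 : R) < 2 ^+ #|E| by rewrite exprn_gt0.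
rewrite -(ler_pM2l two0) mulr1 mulr_sumr.
apply: (@le_trans _ _ (\sum_(g : {set E} | is_cluster g && (e \in g))
   #|[set w : {set E} | w :&: halo g == g]|%:R)).
  apply: ler_sum => g /andP[gc eg].
  apply: (@le_trans _ _ ((2 ^ (#|E| - #|halo g|))%:R)).
    rewrite natrX exprB ?max_card // ?unitfE ?pnatr_eq0 //.
    rewrite ler_pM2l // -exprVn; apply: ler_wiXn2l; last exact: card_halo_le.
      by rewrite invr_ge0.
    by rewrite invf_le1 ?ler1n.
  by rewrite ler_nat card_fixed_trace // halo_self.
rewrite -natr_sum -natrX ler_nat.
apply: (@leq_trans #|{: {set E}}|); last first.
  rewrite -[in X in (_ <= X)%N]cardsT -card_powerset; apply: eq_leq.
  by apply: eq_card => w; rewrite [RHS]inE subsetT.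
apply: (@leq_trans (\sum_(w : {set E})
  \sum_(g : {set E} | is_cluster g && (e \in g))
    if w :&: halo g == g then 1 else 0)%N).
  rewrite exchange_big /=; apply: leq_sum => g _.
  by rewrite -sum1_card big_mkcond /=; apply: leq_sum => w _; rewrite inE.
rewrite -sum1_card; apply: leq_sum => w _.
rewrite -big_mkcondr sum1dep_card cardsE.
apply/card_le1_eqP => g k; rewrite !unfold_in => /andP[/andP[gc eg] /eqP wg].
move=> /andP[/andP[kc ek] /eqP wk].
have gw := clusters_local gc wg; have kw := clusters_local kc wk.
by rewrite -(clusters_cluster_of gw eg) (clusters_cluster_of kw ek).
Qed.
End Clusters.

(** * Contours of spin configurations on a square grid *)

Section Grid.
Variable l : nat.
Definition grid : finType := ('I_l.+1 * 'I_l.+1)%type.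
(** A bond is a direction and its lower endpoint: [(false, x)] joins x to the
    site whose first coordinate is larger by one, [(true, x)] is the analogue
    for the second coordinate.  Bonds pointing out of the square are harmless,
    since they have no upper endpoint in the sense of [bond_to]. *)
Definition bond : finType := (bool * grid)%type.
Implicit Types (f : grid -> bool) (e : bond) (x y : grid) (W : {set grid}) (g : {set bond}).

Definition close x y :=
  [&& x.1 <= y.1.+1, y.1 <= x.1.+1, x.2 <= y.2.+1 & y.2 <= x.2.+1].

Definition bond_to e y :=
  if e.1 then (e.2.1 == y.1) && (e.2.2.+1 == y.2 :> nat)
  else (e.2.1.+1 == y.1 :> nat) && (e.2.2 == y.2).

(** Coarser than sharing a plaquette, but still of bounded degree, and simple to
    compute with. *)
Definition touch : rel bond := fun e e' => close e.2 e'.2.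

Definition disagreements f : {set bond} :=
  [set e | [exists y, bond_to e y && (f e.2 != f y)]].

Lemma close_sym x y : close x y = close y x.
Proof. by apply/and4P/and4P => -[? ? ? ?]; split. Qed.

Lemma close_refl x : close x x.
Proof. by rewrite /close !leqnSn. Qed.

Lemma touch_sym : symmetric touch.
Proof. by move=> e e'; exact: close_sym. Qed.

Lemma bond_to_close e y : bond_to e y -> close e.2 y.
Proof.
rewrite /bond_to /close; case: e.1 => /andP[].
  by move=> /eqP/(congr1 val)/= -> /eqP <-; rewrite !leqnSn leqnn !andbT ltnW.
by move=> /eqP <- /eqP/(congr1 val)/= ->; rewrite !leqnSn leqnn !andbT ltnW.
Qed.

Lemma bond_to_inj e y y' : bond_to e y -> bond_to e y' -> y = y'.
Proof.
case: y y' => [y1 y2] [y1' y2']; rewrite /bond_to /=; case: e.1 => /andP[].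
  move=> /eqP <- /eqP h /andP[/eqP <- /eqP h']; congr pair; apply: val_inj => /=.
  by rewrite -h -h'.
move=> /eqP h /eqP <- /andP[/eqP h' /eqP <-]; congr pair; apply: val_inj => /=.
by rewrite -h -h'.
Qed.

Lemma bond_to_sum e y : bond_to e y -> y.1 + y.2 = (e.2.1 + e.2.2).+1 :> nat.
Proof.
rewrite /bond_to; case: e.1 => /andP[]; first by move=> /eqP -> /eqP <-; rewrite addnS.
by move=> /eqP <- /eqP ->; rewrite addSn.
Qed.

Lemma bond_to_dir b x y : bond_to (b, x) y -> b = (x.1 == y.1).
Proof.
rewrite /bond_to /=; case: b => /andP[/eqP h _]; first by rewrite h eqxx.
by apply/esym/eqP => h'; move: h; rewrite h'; apply/eqP; rewrite gtn_eqF.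
Qed.

Lemma disagreementsE f e y : bond_to e y -> (e \in disagreements f) = f e.2 (+) f y.
Proof.
move=> ey; rewrite inE; apply/existsP/idP => [[z /andP[ez]]|h].
  by rewrite (bond_to_inj ez ey); case: (f _) (f _) => [] [].
by exists y; rewrite ey; case: (f _) (f _) h => [] [].
Qed.

Lemma disagreementsP f e : e \in disagreements f -> exists y, bond_to e y.
Proof. by rewrite inE => /existsP[y /andP[ey _]]; exists y. Qed.

Lemma eq_disagreements f f' : f =1 f' -> disagreements f = disagreements f'.
Proof.
move=> ff'; apply/setP => e; rewrite !inE; apply: eq_existsb => y.
by rewrite !ff'.
Qed.

(** 18 = 2 directions times 3 * 3 positions of the lower endpoint. *)
Lemma card_close x : #|[set e : bond | close x e.2]| <= 18.
Proof.
pose F (e : bond) : bool * ('I_3 * 'I_3) :=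
  (e.1, (inord (e.2.1.+1 - x.1), inord (e.2.2.+1 - x.2))).
have inj : {in [set e : bond | close x e.2] &, injective F}.
  move=> [b [i j]] [b' [i' j']]; rewrite !inE /close /= => h h'.
  case=> -> /(congr1 val) h1 /(congr1 val) h2; move: h1 h2; rewrite /= !inordK; try lia.
  by move=> h1 h2; congr (_, (_, _)); apply: val_inj => /=; lia.
rewrite -(card_in_imset inj); apply: leq_trans (max_card _) _.
by rewrite !card_prod card_bool !card_ord.
Qed.

Lemma card_halo_touch e : #|halo touch [set e]| <= 18.
Proof.
apply: leq_trans (card_close e.2); apply: subset_leq_card; apply/subsetP => e'.
move=> /haloP[/set1P ->|[k /set1P ->]]; rewrite inE //; exact: close_refl.
Qed.

Definition mkg (i j : nat) : grid := (inord i, inord j).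

Lemma mkgK x : mkg x.1 x.2 = x.
Proof. by case: x => i j; rewrite /mkg !inord_val. Qed.

Lemma bond_to_h i j : i < l -> bond_to (false, mkg i j) (mkg i.+1 j).
Proof. by move=> il; rewrite /bond_to /= !inordK ?eqxx // ltnS ltnW. Qed.

Lemma bond_to_v i j : j < l -> bond_to (true, mkg i j) (mkg i j.+1).
Proof. by move=> il; rewrite /bond_to /= !inordK ?eqxx // ltnS ltnW. Qed.

Lemma close_mkg i j i' j' : i <= l -> j <= l -> i' <= l -> j' <= l ->
  i <= i'.+1 -> i' <= i.+1 -> j <= j'.+1 -> j' <= j.+1 ->
  close (mkg i j) (mkg i' j').
Proof. by move=> *; rewrite /close /= !inordK //; apply/and4P; split. Qed.

Lemma disagreements_plaquette f i j : i < l -> j < l ->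
  let m b k k' := (b, mkg k k') \in disagreements f in
  m false i j (+) m true i.+1 j = m false i j.+1 (+) m true i j.
Proof.
move=> il jl /=; rewrite (disagreementsE f (bond_to_h _ il)) (disagreementsE f (bond_to_h _ il)).
rewrite (disagreementsE f (bond_to_v _ jl)) (disagreementsE f (bond_to_v _ jl)) /=.
by do 4 case: (f _).
Qed.

(** The four bonds of a plaquette touch each other, so a cluster contains all
    or none of the disagreements of a plaquette, and their number is even. *)
Lemma cluster_plaquette f g i j : g \in clusters touch (disagreements f) -> i < l -> j < l ->
  let m b k k' := (b, mkg k k') \in g in
  m false i j (+) m true i.+1 j = m false i j.+1 (+) m true i j.
Proof.
move=> gf il jl /=.
pose p : seq bond := [:: (false, mkg i j); (true, mkg i.+1 j);
  (false, mkg i j.+1); (true, mkg i j)].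
have near : {in p &, forall e e', touch e e'}.
  move=> e e'; rewrite !inE => /or4P[] /eqP -> /or4P[] /eqP ->;
   rewrite /touch; apply: close_mkg; lia.
have [/hasP[e ep eg]|/hasPn none] := boolP (has (mem g) p).
  have same e' : e' \in p -> (e' \in g) = (e' \in disagreements f).
    move=> e'p; apply/idP/idP; first exact: (subsetP (clusters_sub gf)).
    by move=> e'f; exact: (clusters_closed touch_sym gf eg e'f (near _ _ ep e'p)).
  by rewrite !same; [exact: disagreements_plaquette | rewrite !inE eqxx ?orbT..].
have no e : e \in p -> (e \in g) = false by move=> /none/negbTE.
by rewrite !no // !inE eqxx ?orbT.
Qed.

(** The square is simply connected: a set of bonds that is even on every
    plaquette is the set of disagreements of some W.  Membership in W is the
    parity of the number of bonds crossed along the path that leaves the corner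
    vertically and then goes on horizontally. *)
Lemma cluster_is_boundary f g : g \in clusters touch (disagreements f) ->
  exists W, disagreements (fun x => x \in W) = g.
Proof.
move=> gf.
pose H i j := (false, mkg i j) \in g; pose V i j := (true, mkg i j) \in g.
pose w i j := (\big[addb/false]_(k < j) V 0 k) (+) (\big[addb/false]_(k < i) H k j).
have wH i j : w i j (+) w i.+1 j = H i j.
  rewrite /w [\big[_/_]_(_ < i.+1) _]big_ord_recr /=.
  set S := \big[_/_]_(_ < j) _; set Q := \big[_/_]_(_ < i) _.
  by case: S Q (H i j) => [] [] [].
have wV i j : i <= l -> j < l -> w i j (+) w i j.+1 = V i j.
  move=> + jl; elim: i => [|i IH] il.
    by rewrite /w !big_ord0 big_ord_recr /= !addbF addbA addbb.
  have := IH (ltnW il); have := wH i j; have := wH i j.+1.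
  have := cluster_plaquette gf il jl; rewrite /= -/(H _ _) -/(H _ _) -/(V _ _) -/(V _ _).
  by case: (w i j) (w i.+1 j) (w i j.+1) (w i.+1 j.+1) (H i j) (H i j.+1) (V i j)
   (V i.+1 j) => [] [] [] [] [] [] [] [].
exists [set x : grid | w x.1 x.2]; apply/setP => -[b x].
have [/existsP[y xy]|none] := boolP [exists y, bond_to (b, x) y]; last first.
  transitivity false.
    by apply/negP => /disagreementsP[y xy]; case/existsP: none; exists y.
  symmetry; apply/negP => /(subsetP (clusters_sub gf))/disagreementsP[y xy].
  by case/existsP: none; exists y.
rewrite (disagreementsE _ xy) !inE /= -[X in (_, X)]mkgK.
move: xy; rewrite /bond_to /=; case: b => /andP[/eqP h1 /eqP h2].
  rewrite -h1 -h2 wV //; first by rewrite -ltnS.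
  by rewrite -ltnS h2.
by rewrite -h1 -h2 wH.
Qed.

Lemma disagreements0_const f : disagreements f = set0 -> forall x y, f x = f y.
Proof.
move=> f0.
have same e y : bond_to e y -> f e.2 = f y.
  by move=> ey; have := disagreementsE f ey; rewrite f0 inE; case: (f _) (f _) => [] [].
have H i j : i <= l -> f (mkg i j) = f (mkg 0 j).
  by elim: i => // i IH il; rewrite -(same _ _ (bond_to_h j il)) IH // ltnW.
have V j : j <= l -> f (mkg 0 j) = f (mkg 0 0).
  by elim: j => // j IH jl; rewrite -(same _ _ (bond_to_v 0 jl)) IH // ltnW.
suff all0 x : f x = f (mkg 0 0) by move=> x y; rewrite !all0.
by rewrite -(mkgK x) H ?V // -ltnS.
Qed.

(** Fewer disagreements than lines leave a row and a column without any
    disagreement, and these meet, hence have a common value c.  The sites with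
    another value lie in a row and in a column that both contain the lower
    endpoint of a disagreement: at most k rows and k columns. *)
Lemma isoperimetry f (k : nat) : #|disagreements f| <= k -> k <= l ->
  exists c, #|[set x | f x != c]| <= k ^ 2.
Proof.
move=> fk kl.
pose A : {set 'I_l.+1} := [set e.2.2 | e in disagreements f].
pose B : {set 'I_l.+1} := [set e.2.1 | e in disagreements f].
have cA : #|A| <= k by apply: leq_trans (leq_imset_card _ _) fk.
have cB : #|B| <= k by apply: leq_trans (leq_imset_card _ _) fk.
have ex (S : {set 'I_l.+1}) : #|S| <= k -> exists i, i \notin S.
  move=> Sk; apply/existsP; rewrite -negb_forall; apply/negP => /forallP all.
  have : #|'I_l.+1| <= #|S| by apply: subset_leq_card; apply/subsetP => i _.
  by rewrite card_ord; lia.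
have row j : j \notin A -> forall i i', f (i, j) = f (i', j).
  move=> jA.
  have H i : i <= l -> f (inord i, j) = f (inord 0, j).
    elim: i => // i IH il; rewrite -IH; last exact: ltnW.
    have h := bond_to_h j il; rewrite /mkg inord_val in h.
    have := disagreementsE f h; have /negbTE -> : (false, (inord i, j)) \notin disagreements f.
      by apply: contra jA => h'; apply/imsetP; exists (false, (inord i, j)).
    by rewrite /=; case: (f _) (f _) => [] [].
  by move=> i i'; rewrite -(inord_val i) -(inord_val i') !H // -ltnS.
have col i : i \notin B -> forall j j', f (i, j) = f (i, j').
  move=> iB.
  have H j : j <= l -> f (i, inord j) = f (i, inord 0).
    elim: j => // j IH jl; rewrite -IH; last exact: ltnW.
    have h := bond_to_v i jl; rewrite /mkg inord_val in h.
    have := disagreementsE f h; have /negbTE -> : (true, (i, inord j)) \notin disagreements f.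
      by apply: contra iB => h'; apply/imsetP; exists (true, (i, inord j)).
    by rewrite /=; case: (f _) (f _) => [] [].
  by move=> j j'; rewrite -(inord_val j) -(inord_val j') !H // -ltnS.
have [j0 j0A] := ex _ cA; have [i0 i0B] := ex _ cB.
exists (f (i0, j0)).
apply: (@leq_trans #|setX B A|); last by rewrite cardsX -mulnn leq_mul.
apply: subset_leq_card; apply/subsetP => -[i j]; rewrite !inE /= => ne.
apply/andP; split; apply: contraNT ne => h; apply/eqP.
  by rewrite (col _ h j j0); exact: row.
by rewrite (row _ h i i0); exact: col.
Qed.

Variable k : nat.
Hypothesis kl : k <= l.

(** Of the two sets bounded by g, the small one. *)
Definition filling g : {set grid} :=
  odflt set0 [pick W : {set grid} | (disagreements (fun x => x \in W) == g) && (#|W| <= k ^ 2)].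

Lemma card_filling g : #|filling g| <= k ^ 2.
Proof.
by rewrite /filling; case: pickP => [W /andP[_ h]|_] //=; rewrite cards0.
Qed.

Lemma disagreements_filling f g : g \in clusters touch (disagreements f) -> #|g| <= k ->
  disagreements (fun x => x \in filling g) = g.
Proof.
move=> gf gk; rewrite /filling; case: pickP => [W /andP[/eqP h _] //|none].
have [W0 W0g] := cluster_is_boundary gf.
have [c hc] := isoperimetry (f := fun x => x \in W0) ltac:(by rewrite W0g; exact: gk) kl.
have := none [set x | (x \in W0) != c]; rewrite hc andbT => /eqP[].
rewrite -W0g; apply/setP => e; rewrite !inE; apply: eq_existsb => y.
by rewrite !inE; case: bond_to => //; case: (_ \in W0) (_ \in W0) c {hc} => [] [] [].
Qed.

Definition small_contours (n : nat) f := forall g, g \in clusters touch (disagreements f) -> #|g| <= n.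

Definition inside_contours f x : bool :=
  \big[addb/false]_(g in clusters touch (disagreements f)) (x \in filling g).

(** [inside_contours f] has the same disagreements as f when the contours are
    small, hence f is this function or its negation; the phase tells which. *)
Definition in_phase (c : bool) f := small_contours k f /\ forall x, f x = c (+) inside_contours f x.

Lemma disagreements_addb f f' : disagreements (fun x => f x (+) f' x) =
  [set e | (e \in disagreements f) (+) (e \in disagreements f')].
Proof.
apply/setP => e; rewrite [RHS]inE.
have [/existsP[y ey]|none] := boolP [exists y, bond_to e y].
  by rewrite !(disagreementsE _ ey) addbACA.
have n f1 : (e \in disagreements f1) = false.
  by apply/negP => /disagreementsP[y ey]; case/existsP: none; exists y.
by rewrite !n.
Qed.

(** The fillings superpose modulo 2 and their boundaries are the clusters,
    which partition the disagreements. *)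
Lemma disagreements_inside f : small_contours k f -> disagreements (inside_contours f) = disagreements f.
Proof.
move=> sf.
have big (s : seq {set bond}) : {subset s <= clusters touch (disagreements f)} ->
  disagreements (fun x => \big[addb/false]_(g <- s) (x \in filling g)) =
  [set e | \big[addb/false]_(g <- s) (e \in g)].
  elim: s => [|g s IH] sub.
    apply/setP => e; rewrite !inE [RHS]big_nil; apply/existsP => -[y].
    by rewrite !big_nil andbF.
  have gf : g \in clusters touch (disagreements f) by apply: sub; rewrite mem_head.
  rewrite (@eq_disagreements _ (fun x => (x \in filling g) (+)
    \big[addb/false]_(g <- s) (x \in filling g))); last by move=> x; rewrite big_cons.
  rewrite disagreements_addb (disagreements_filling gf (sf _ gf)) IH.
    by apply/setP => e; rewrite !inE big_cons.
  by move=> g' g's; apply: sub; rewrite inE g's orbT.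
rewrite (@eq_disagreements _ (fun x => \big[addb/false]_(g <- enum (clusters touch (disagreements f)))
   (x \in filling g))); last by move=> x; rewrite /inside_contours big_enum.
rewrite big; last by move=> g; rewrite mem_enum.
by apply/setP => e; rewrite inE big_enum addb_clusters //; exact: touch_sym.
Qed.

Lemma in_phase_const c : in_phase c (fun=> c).
Proof.
have c0 : disagreements (fun=> c) = set0.
  by apply/setP => e; rewrite in_set0 inE; apply/existsP => -[y]; rewrite eqxx andbF.
have n0 g : g \in clusters touch (disagreements (fun=> c)) = false.
  apply/negP => gc; have [e eg] := clusters_n0 gc.
  by have := subsetP (clusters_sub gc) _ eg; rewrite c0 inE.
split=> [g|x]; first by rewrite n0.
by rewrite /inside_contours big1 ?addbF // => g; rewrite n0.
Qed.

Lemma in_phase_inj c c' f : in_phase c f -> in_phase c' f -> c = c'.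
Proof.
move=> [_ /(_ (mkg 0 0)) h] [_ /(_ (mkg 0 0)) h']; move: h'; rewrite h.
by case: (inside_contours _ _) c c' {h} => [] [] [].
Qed.

Lemma in_phase_remove c f g : in_phase c f -> g \in clusters touch (disagreements f) ->
  in_phase c (fun x => f x (+) (x \in filling g)).
Proof.
move=> [sf fE] gf; set f' := fun x => _.
have cutf' : disagreements f' = disagreements f :\: g.
  rewrite disagreements_addb (disagreements_filling gf (sf _ gf)); apply/setP => e; rewrite inE in_setD.
  have [eg|] := boolP (e \in g); last by rewrite addbF.
  by rewrite (subsetP (clusters_sub gf) _ eg).
have cl : clusters touch (disagreements f') = clusters touch (disagreements f) :\ g.
  by rewrite cutf' (clusters_remove touch_sym gf).
split=> [g'|x]; first by rewrite cl => /setD1P[_]; exact: sf.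
rewrite /inside_contours cl; rewrite /f' fE /inside_contours (bigD1 g) //=.
rewrite [in RHS](eq_bigl (fun g' => (g' \in clusters touch (disagreements f)) && (g' != g))); last first.
  by move=> g'; rewrite in_setD1 andbC.
by case: (\big[_/_]_(_ | _) _) (x \in _) c {fE} => [] [] [].
Qed.

Definition flip_site f v x := f x (+) (x == v).

(** Two scales of contours.  A flip at v only affects disagreements at distance
    one from v; at most 18 bonds are involved, and their halo has at most
    324 = 18 * 18 bonds, hence meets at most 324 contours. *)
Section Flip.
Variables (m : nat) (v : grid).
Hypothesis mk : 18 + 324 * m <= k.
Hypothesis kk : 648 * k ^ 2 + 1 < l.+1 ^ 2.

Let T : {set bond} := [set e | close v e.2].

Lemma flip_site_agree f e : e \notin T -> (e \in disagreements f) = (e \in disagreements (flip_site f v)).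
Proof.
rewrite inE => ev.
have [/existsP[y ey]|none] := boolP [exists y, bond_to e y].
  have xv : e.2 != v by apply: contraNneq ev => ->; exact: close_refl.
  have yv : y != v.
    by apply: contraNneq ev => <-; rewrite close_sym; exact: bond_to_close.
  by rewrite !(disagreementsE _ ey) /flip_site (negbTE xv) (negbTE yv) !addbF.
have n f1 : (e \in disagreements f1) = false.
  by apply/negP => /disagreementsP[y ey]; case/existsP: none; exists y.
by rewrite !n.
Qed.

Lemma card_haloT : #|halo touch T| <= 324.
Proof.
apply: leq_trans (card_halo_le _ (@card_halo_touch)) _.
by have := card_close v; rewrite -/T; lia.
Qed.

Lemma small_contours_flip f : small_contours m f -> small_contours k (flip_site f v).
Proof.
move=> sf g gf'.
have [g0|/set0Pn[e /setIP[eg eT]]] := eqVneq (g :&: halo touch T) set0.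
  have := sf _ (clusters_far touch_sym (@flip_site_agree f) gf' g0).
  by lia.
have := clusters_near_card touch_sym (@flip_site_agree f) gf' eg eT sf.
move/leq_trans; apply; apply: leq_trans mk.
by apply: leq_add; [exact: card_close | rewrite leq_mul // card_haloT].
Qed.

(** The contours that differ before and after the flip meet the halo of T, so
    [inside_contours] changes at most on v and on 2 * 324 fillings of size at
    most k^2.  But its change and the indicator of v have the same
    disagreements, hence are equal or complementary, and the second case is
    excluded because [648 * k ^ 2 + 1] sites do not cover the square. *)
Lemma in_phase_flip c f : small_contours m f -> in_phase c f -> in_phase c (flip_site f v).
Proof.
move=> smf [sf fE]; have sf' := small_contours_flip smf; split=> //.
set f' := flip_site f v.
pose near h := [set g in clusters touch (disagreements h) | g :&: halo touch T != set0].
pose U h := \bigcup_(g in near h) filling g.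
have cU h : #|U h| <= 324 * k ^ 2.
  apply: (@leq_trans (\sum_(g in near h) k ^ 2)).
    rewrite /U; elim/big_rec2: _ => [|g s V _ IH]; first by rewrite cards0.
    by apply: leq_trans (leq_card_setU _ _) _; rewrite leq_add ?card_filling.
  rewrite sum_nat_const leq_mul2r; apply/orP; right.
  exact: leq_trans (card_clusters_meet touch_sym _ _) card_haloT.
have far x : x \notin U f -> x \notin U f' -> inside_contours f x = inside_contours f' x.
  move=> xU xU'.
  have red h : x \notin U h -> inside_contours h x =
      \big[addb/false]_(g in clusters touch (disagreements h) | g :&: halo touch T == set0)
        (x \in filling g).
    move=> xh; rewrite /inside_contours (bigID (fun g => g :&: halo touch T == set0)) /=.
    rewrite [X in _ (+) X]big1 ?addbF // => g /andP[gc gT].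
    apply/negbTE; apply: contra xh => xg; apply/bigcupP; exists g => //.
    by rewrite inE gc.
  rewrite !red //; apply: eq_bigl => g; apply/andP/andP => -[gc /eqP g0]; split;
    rewrite ?g0 //.
    by apply: (clusters_far touch_sym _ gc g0) => e eT; exact/esym/flip_site_agree.
  exact: (clusters_far touch_sym (@flip_site_agree f) gc g0).
pose d x := (inside_contours f x (+) inside_contours f' x) (+) (x == v).
have d0 : disagreements d = set0.
  have cf' e : (e \in disagreements f') = (e \in disagreements f) (+) (e \in disagreements (fun x => x == v)).
    by rewrite /f' [disagreements (flip_site f v)]disagreements_addb inE.
  apply/setP => e; rewrite /d disagreements_addb [LHS]inE disagreements_addb.
  rewrite [X in X (+) _]inE !disagreements_inside // cf' in_set0.
  by rewrite addKb addbb.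
have dc := disagreements0_const d0.
have d_false x : d x = false.
  apply/negP => dx.
  have : #|grid| <= #|U f :|: U f' :|: [set v]|.
    apply: subset_leq_card; apply/subsetP => y _; rewrite !inE.
    have [-> |yv] := eqVneq y v; first by rewrite orbT.
    rewrite orbF; apply: contraT; rewrite negb_or => /andP[yU yU'].
    by move: dx; rewrite (dc x y) /d (negbTE yv) far // addbb.
  rewrite card_prod !card_ord => big.
  have [h1 _] := leq_card_setU (U f :|: U f') [set v].
  have [h2 _] := leq_card_setU (U f) (U f').
  have h3 := cU f; have h4 := cU f'; move: h1; rewrite cards1 => h1.
  have /leq_trans/(_ h1) := big; rewrite leqNgt => /negP; apply.
  rewrite mulnn; apply: leq_ltn_trans kk. by lia.
move=> x; have := d_false x; rewrite /d -[f' x]/(f x (+) (x == v)) fE.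
by case: (inside_contours f x) (inside_contours f' x) (x == v) c {fE} => [] [] [] [].
Qed.
End Flip.
End Grid.

From mathcomp Require Import all_classical all_reals all_analysis.
From mathcomp Require Import measurable_realfun.

Import numFieldNormedType.Exports.

Local Open Scope classical_set_scope.
Local Open Scope ring_scope.

(** * Single-site heat-bath kernels and their Euler schemes *)

(** Closes the estimates obtained from Euler schemes of mesh 1 / n. *)
Lemma ler_addinvn (R : realType) (x y C : R) :
  (forall n : nat, x <= y + C / n.+1%:R) -> x <= y.
Proof.
move=> xy; have [C0|C0] := leP C 0.
  apply: (le_trans (xy 0%N)); rewrite gerDl.
  by rewrite mulr_le0_ge0 // invr_ge0.
apply/ler_addgt0Pr => e e0.
have /ltW ne : C / e < (Num.truncn (C / e)).+1%:R by rewrite truncnS_gt.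
apply: (le_trans (xy (Num.truncn (C / e)))); rewrite lerD2l.
by rewrite ler_pdivrMr // mulrC -ler_pdivrMr.
Qed.

Lemma ler_expR_inv1 (R : realType) (x : R) : expR (- x) * (1 + x) <= 1.
Proof.
rewrite -[leRHS](expRxMexpNx_1 x) mulrC ler_wpM2r ?expR_ge0 //.
exact: expR_ge1Dx.
Qed.

Lemma expR_inv1_ge (R : realType) (x : R) : 0 <= x -> 1 - x ^+ 2 <= expR (- x) * (1 + x).
Proof.
move=> x0; have -> : 1 - x ^+ 2 = (1 - x) * (1 + x) by ring.
by rewrite ler_wpM2r ?addr_ge0 // expR_ge1Dx.
Qed.

Section Kernel.
Variables (R : realType) (V : finType) (e : rel V) (beta : R) (h : V -> R).
Notation mu := (rfim e beta h).
Implicit Types (s r : config V) (v : V) (S : pred (config V)).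

Lemma rfim_gt0 s : 0 < mu s.
Proof.
rewrite divr_gt0 ?expR_gt0 //.
by rewrite (bigD1 s) //= ltr_pwDl ?expR_gt0 // sumr_ge0 // => r _; exact: expR_ge0.
Qed.

Lemma sum_rfim : \sum_s mu s = 1.
Proof.
rewrite -mulr_suml mulfV // gt_eqF // (bigD1 [ffun=> true]) //=.
by rewrite ltr_pwDl ?expR_gt0 // sumr_ge0 // => r _; exact: expR_ge0.
Qed.

Lemma rfim_ge0 s : 0 <= mu s. Proof. exact/ltW/rfim_gt0. Qed.
Hint Resolve rfim_ge0 : core.

Definition agree v s r := set_spin s v true == set_spin r v true.

(** The resampling kernel at v, written so that reversibility is apparent: the
    normalisation only depends on the spins off v. *)
Definition kernel v s r : R :=
  if agree v s r then mu r / (mu (set_spin s v true) + mu (set_spin s v false)) else 0.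

Lemma agree_sym v s r : agree v s r = agree v r s.
Proof. exact: eq_sym. Qed.

Lemma agreeP v s r : reflect (forall u, u != v -> s u = r u) (agree v s r).
Proof.
apply: (iffP eqP) => [/ffunP sr u uv|sr].
  by have := sr u; rewrite !ffunE (negbTE uv).
by apply/ffunP => u; rewrite !ffunE; case: eqVneq => // /sr.
Qed.

Lemma set_spin_agree v s r b : agree v s r -> set_spin s v b = set_spin r v b.
Proof. by move=> /agreeP sr; apply/ffunP => u; rewrite !ffunE; case: eqVneq => // /sr. Qed.

Lemma agree_set_spin v s b : agree v s (set_spin s v b).
Proof. by apply/agreeP => u uv; rewrite ffunE (negbTE uv). Qed.

Lemma agree_cases v s r : agree v s r -> r = set_spin s v (r v).
Proof.
move=> /agreeP sr; apply/ffunP => u; rewrite ffunE; case: eqVneq => [->//|/sr //].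
Qed.

Lemma set_spin_neq v s : set_spin s v true != set_spin s v false.
Proof. by apply/eqP => /ffunP/(_ v); rewrite !ffunE eqxx. Qed.

Lemma kernel_ge0 v s r : 0 <= kernel v s r.
Proof. by rewrite /kernel; case: ifP => // _; rewrite divr_ge0 ?addr_ge0. Qed.

Lemma kernel_sum_pair v s (F : config V -> R) :
  \sum_(r | agree v s r) F r = F (set_spin s v true) + F (set_spin s v false).
Proof.
rewrite (bigD1 (set_spin s v true)) ?agree_set_spin //=.
rewrite (bigD1 (set_spin s v false)) /=; last first.
  by rewrite agree_set_spin eq_sym set_spin_neq.
rewrite big1 ?addr0 // => r /andP[/andP[sr n1] n2].
by move: n1 n2; rewrite (agree_cases sr); case: (r v); rewrite eqxx.
Qed.

Lemma sum_kernel v s : \sum_r kernel v s r = 1.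
Proof.
rewrite -big_mkcond /= kernel_sum_pair -mulrDl mulfV //.
by rewrite gt_eqF // addr_gt0 // rfim_gt0.
Qed.

Lemma kernel_reversible v s r : mu s * kernel v s r = mu r * kernel v r s.
Proof.
rewrite /kernel agree_sym; case: ifP => [sr|_]; last by rewrite !mulr0.
by rewrite !(set_spin_agree _ sr) mulrCA.
Qed.

Lemma kernel_stationary v r : \sum_s mu s * kernel v s r = mu r.
Proof.
under eq_bigr do rewrite kernel_reversible.
by rewrite -mulr_sumr sum_kernel mulr1.
Qed.

Lemma kernel_le1 v s r : kernel v s r <= 1.
Proof.
rewrite -(sum_kernel v s) (bigD1 r) //= lerDl sumr_ge0 // => *; exact: kernel_ge0.
Qed.

Definition flip_at s v : config V := set_spin s v (~~ s v).

Lemma kernel_flip_le v s : kernel v s (flip_at s v) <= mu (flip_at s v) / mu s.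
Proof.
rewrite /kernel /flip_at agree_set_spin.
have ss : s = set_spin s v (s v).
  by apply/ffunP => u; rewrite ffunE; case: eqVneq => [->|].
rewrite ler_wpM2l // lef_pV2 ?posrE ?addr_gt0 ?rfim_gt0 //.
by rewrite {1}ss; case: (s v); rewrite ?lerDl ?lerDr.
Qed.

(** Starting in S, the only transition at v that can leave S is the flip. *)
Lemma kernel_exit v s S : S s ->
  \sum_(r | ~~ S r) kernel v s r <= (~~ S (flip_at s v))%:R * kernel v s (flip_at s v).
Proof.
move=> Ss; rewrite big_mkcond (bigID (agree v s)) /= [X in _ + X]big1 ?addr0; last first.
  by move=> r; rewrite /kernel; case: ifP => //; case: ifP.
rewrite kernel_sum_pair /flip_at.
have ss : s = set_spin s v (s v).
  by apply/ffunP => u; rewrite ffunE; case: eqVneq => [->|].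
move: Ss; rewrite {1}ss; case: (s v) => /= ->; rewrite ?add0r ?addr0;
  by case: ifP; rewrite ?mul1r ?mul0r.
Qed.

Definition nsites : R := #|V|%:R.
(** The exact probability that during a time d no clock rings and s = r, or
    exactly one clock rings and the update leads from s to r.  Discarding
    multiple rings makes the kernel substochastic, with mass [step_mass d]. *)
Definition euler (d : R) s r : R :=
  expR (- (nsites * d)) * ((s == r)%:R + d * \sum_v kernel v s r).
Definition step_mass (d : R) : R := expR (- (nsites * d)) * (1 + nsites * d).

Lemma nsites_ge0 : 0 <= nsites. Proof. by []. Qed.
Hint Resolve nsites_ge0 : core.

Lemma euler_ge0 d s r : 0 <= d -> 0 <= euler d s r.
Proof.
move=> d0; rewrite mulr_ge0 ?expR_ge0 // addr_ge0 // mulr_ge0 // sumr_ge0 // => *.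
exact: kernel_ge0.
Qed.

Lemma sum_deltal (s : config V) (F : config V -> R) : \sum_r (s == r)%:R * F r = F s.
Proof.
rewrite (bigD1 s) //= eqxx mul1r big1 ?addr0 // => r; rewrite eq_sym => /negbTE ->.
by rewrite mul0r.
Qed.

Lemma sum_euler d s : \sum_r euler d s r = step_mass d.
Proof.
rewrite -mulr_sumr big_split /= -mulr_sumr exchange_big /=.
under [X in _ * (_ + _ * X)]eq_bigr do rewrite sum_kernel.
rewrite sumr_const -mulr_natr mul1r.
under eq_bigr do rewrite -[_%:R]mulr1.
by rewrite sum_deltal [d * _]mulrC.
Qed.

Lemma euler_stationary d r : \sum_s mu s * euler d s r = step_mass d * mu r.
Proof.
rewrite /euler.
under eq_bigr do rewrite mulrCA mulrDr.
rewrite -mulr_sumr big_split /=.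
under eq_bigr do rewrite mulrC eq_sym.
rewrite sum_deltal.
under [X in _ * (_ + X)]eq_bigr do rewrite mulrCA mulr_sumr.
rewrite -mulr_sumr exchange_big /=.
under [X in _ * (_ + _ * X)]eq_bigr do rewrite kernel_stationary.
rewrite sumr_const -[mu r *+ _]mulr_natr /step_mass; ring.
Qed.

Lemma step_mass_le1 d : step_mass d <= 1. Proof. exact: ler_expR_inv1. Qed.
Lemma step_mass_ge d : 0 <= d -> 1 - (nsites * d) ^+ 2 <= step_mass d.
Proof. by move=> d0; apply: expR_inv1_ge; rewrite mulr_ge0. Qed.
Lemma step_mass_ge0 d : 0 <= d -> 0 <= step_mass d.
Proof. by move=> d0; rewrite mulr_ge0 ?expR_ge0 // addr_ge0 // mulr_ge0. Qed.

Variable eps : nat -> R.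
Hypothesis eps0 : forall i, 0 <= eps i.

Fixpoint chain n s r : R :=
  if n is n'.+1 then \sum_q chain n' s q * euler (eps n') q r else (s == r)%:R.

Definition chain_mass n := \prod_(i < n) step_mass (eps i).

Lemma chain_ge0 n s r : 0 <= chain n s r.
Proof.
elim: n r => [|n IH] r //=; apply: sumr_ge0 => q _.
by rewrite mulr_ge0 // euler_ge0.
Qed.

Lemma sum_chain n s : \sum_r chain n s r = chain_mass n.
Proof.
elim: n => [|n IH] /=.
  under eq_bigr do rewrite -[_%:R]mulr1.
  by rewrite sum_deltal /chain_mass big_ord0.
rewrite exchange_big /=; under eq_bigr do rewrite -mulr_sumr sum_euler.
by rewrite -mulr_suml IH /chain_mass big_ord_recr.
Qed.

Lemma chain_mass_le1 n : chain_mass n <= 1.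
Proof.
elim: n => [|n IH]; rewrite /chain_mass ?big_ord0 // big_ord_recr /= -/(chain_mass n).
by rewrite mulr_ile1 ?step_mass_le1 ?step_mass_ge0 // prodr_ge0 // => i _; exact: step_mass_ge0.
Qed.

Lemma chain_mass_ge n : 1 - \sum_(i < n) (1 - step_mass (eps i)) <= chain_mass n.
Proof.
elim: n => [|n IH]; rewrite /chain_mass ?big_ord0 ?subr0 // !big_ord_recr /= -/(chain_mass n).
have := chain_mass_le1 n; have := step_mass_le1 (eps n); have := step_mass_ge0 (eps0 n).
by move: IH; nra.
Qed.

Lemma chain_stationary n r : \sum_s mu s * chain n s r <= mu r.
Proof.
suff -> : \sum_s mu s * chain n s r = chain_mass n * mu r.
  by rewrite ler_piMl // chain_mass_le1.
elim: n r => [|n IH] r /=.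
  under eq_bigr do rewrite mulrC eq_sym.
  by rewrite sum_deltal /chain_mass big_ord0 mul1r.
under eq_bigr do rewrite mulr_sumr.
rewrite exchange_big /=.
transitivity (\sum_q chain_mass n * (mu q * euler (eps n) q r)).
  apply: eq_bigr => q _; rewrite mulrA -IH mulr_suml.
  by apply: eq_bigr => s _; rewrite mulrA.
by rewrite -mulr_sumr euler_stationary mulrA /chain_mass big_ord_recr.
Qed.

(** The distance to equilibrium is nonincreasing up to the lost mass, since
    the invariant law loses the same proportion of mass. *)
Lemma chain_contract n s :
  \sum_r `|chain n.+1 s r - mu r| <=
  \sum_r `|chain n s r - mu r| + (1 - step_mass (eps n)).
Proof.
have mr r : mu r = \sum_q mu q * euler (eps n) q r + (1 - step_mass (eps n)) * mu r.
  by rewrite euler_stationary; ring.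
have step r : `|chain n.+1 s r - mu r| <=
   \sum_q `|chain n s q - mu q| * euler (eps n) q r + (1 - step_mass (eps n)) * mu r.
  rewrite {1}mr /= opprD addrA -sumrB.
  apply: le_trans (ler_normB _ _) _; apply: lerD; last first.
    by rewrite ger0_norm // mulr_ge0 // subr_ge0 step_mass_le1.
  apply: le_trans (ler_norm_sum _ _ _) _; apply: ler_sum => q _.
  by rewrite -mulrBl normrM (ger0_norm (euler_ge0 _ _ _)).
apply: le_trans (ler_sum _ (fun r _ => step r)) _.
rewrite big_split /= -mulr_sumr sum_rfim mulr1 lerD2r exchange_big /=.
apply: ler_sum => q _; rewrite -mulr_sumr sum_euler.
by rewrite ler_piMr // step_mass_le1.
Qed.

Lemma chain_contracts n m s :
  \sum_r `|chain (n + m) s r - mu r| <=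
  \sum_r `|chain n s r - mu r| + \sum_(i < m) (1 - step_mass (eps (n + i)%N)).
Proof.
elim: m => [|m IH]; first by rewrite addn0 big_ord0 addr0.
rewrite addnS big_ord_recr /= addrA.
by apply: le_trans (chain_contract _ _) _; rewrite lerD2r.
Qed.

(** Started from equilibrium restricted to S, the scheme is dominated by
    equilibrium at all times ([chain_stationary]), so that in each step the
    flow out of S is at most its equilibrium value times the step. *)
Lemma chain_exit S (phi : R) n :
  \sum_(s | S s) mu s * \sum_v \sum_(r | ~~ S r) kernel v s r <= phi ->
  \sum_(s | S s) mu s * \sum_(r | ~~ S r) chain n s r <= (\sum_(i < n) eps i) * phi.
Proof.
move=> Sphi; elim: n => [|n IH] /=.
  rewrite big_ord0 mul0r big1 // => s Ss; rewrite big1 ?mulr0 // => r Sr.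
  by case: eqVneq Sr => [<-|//]; rewrite Ss.
rewrite big_ord_recr /= mulrDl.
under eq_bigr do rewrite exchange_big /= (bigID S) /= mulrDr addrC.
rewrite big_split /=; apply: lerD.
  apply: le_trans IH; apply: ler_sum => s Ss; rewrite ler_wpM2l //.
  apply: ler_sum => q _; rewrite -mulr_sumr ler_piMr ?chain_ge0 //.
  apply: le_trans (step_mass_le1 (eps n)); rewrite -(sum_euler _ q).
  rewrite [leRHS](bigID S) /= lerDr sumr_ge0 // => r _; exact: euler_ge0.
apply: (@le_trans _ _ (\sum_(q | S q) mu q * \sum_(r | ~~ S r) euler (eps n) q r)).
  under eq_bigr do rewrite mulr_sumr.
  rewrite exchange_big /=; apply: ler_sum => q Sq.
  under eq_bigr do rewrite -mulr_sumr mulrA.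
  rewrite -mulr_suml ler_wpM2r //.
    by apply: sumr_ge0 => r _; exact: euler_ge0.
  apply: le_trans (chain_stationary n q).
  rewrite [leRHS](bigID S) /= lerDl sumr_ge0 // => s _.
  by rewrite mulr_ge0 // chain_ge0.
apply: le_trans (ler_wpM2l (eps0 n) Sphi); rewrite mulr_sumr; apply: ler_sum => q Sq.
rewrite mulrCA ler_wpM2l // exchange_big /= mulr_sumr.
apply: ler_sum => r Sr; rewrite /euler.
have -> : (q == r) = false by case: eqVneq Sr => [<-|//]; rewrite Sq.
rewrite add0r ler_piMl //.
  by rewrite mulr_ge0 // sumr_ge0 // => v _; exact: kernel_ge0.
by rewrite -expR0 ler_expR oppr_le0 mulr_ge0.
Qed.

End Kernel.

Lemma dTV_ge (R : realType) (V : finType) (p q : config V -> R) (S : pred (config V)) :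
  \sum_r p r = \sum_r q r -> \sum_(r | S r) q r - \sum_(r | S r) p r <= dTV p q.
Proof.
move=> pq; rewrite /dTV.
have pq' : \sum_(r | S r) q r - \sum_(r | S r) p r =
  \sum_(r | ~~ S r) p r - \sum_(r | ~~ S r) q r.
  by move: pq; rewrite !(bigID S xpredT) /=; lra.
have h1 : \sum_(r | S r) q r - \sum_(r | S r) p r <= \sum_(r | S r) `|p r - q r|.
  by rewrite -sumrB; apply: ler_sum => r _; rewrite distrC ler_norm.
have h2 : \sum_(r | ~~ S r) p r - \sum_(r | ~~ S r) q r <= \sum_(r | ~~ S r) `|p r - q r|.
  by rewrite -sumrB; apply: ler_sum => r _; rewrite ler_norm.
rewrite (bigID S xpredT) /=; lra.
Qed.

(** Any family of probability laws that dominates all the Euler schemes is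
    determined by them; all the properties of the dynamics that matter for the
    mixing time follow from this domination. *)
Section Semigroup.
Variables (R : realType) (V : finType) (e : rel V) (beta : R) (h : V -> R).
Notation mu := (rfim e beta h).
Variable law : config V -> R -> config V -> R.
Hypothesis law1 : forall s t, 0 <= t -> \sum_r law s t r = 1.
Hypothesis law_ge : forall s (eps : nat -> R) n r, (forall i, 0 <= eps i) ->
  chain e beta h eps n s r <= law s (\sum_(i < n) eps i) r.

Lemma law_chain s (eps : nat -> R) n : (forall i, 0 <= eps i) ->
  \sum_r `|law s (\sum_(i < n) eps i) r - chain e beta h eps n s r|
    <= \sum_(i < n) (nsites R V * eps i) ^+ 2.
Proof.
move=> eps0; under eq_bigr do rewrite ger0_norm ?subr_ge0 ?law_ge //.
rewrite sumrB sum_chain law1; last by apply: sumr_ge0.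
rewrite lerBlDr -lerBlDl; apply: le_trans (chain_mass_ge V eps0 n).
rewrite lerD2l lerN2; apply: ler_sum => i _.
by rewrite lerBlDr -lerBlDl step_mass_ge.
Qed.

Lemma sum_const_div (t : R) n : \sum_(i < n.+1) t / n.+1%:R = t.
Proof. by rewrite sumr_const card_ord -[LHS]mulr_natr divfK // pnatr_eq0. Qed.

Lemma sum_sqr_div (t : R) n :
  \sum_(i < n.+1) (nsites R V * (t / n.+1%:R)) ^+ 2 = (nsites R V * t) ^+ 2 / n.+1%:R.
Proof.
rewrite sumr_const card_ord -[LHS]mulr_natr; field.
by rewrite -[1]/(1%:R) -natrD pnatr_eq0.
Qed.

(** Compare with a scheme of n + 1 equal steps up to t followed by n + 1 equal
    steps from t to t'; all the errors are O(1 / n). *)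
Lemma dTV_law_noninc s (t t' : R) : 0 <= t -> t <= t' ->
  dTV (law s t') mu <= dTV (law s t) mu.
Proof.
move=> t0 tt'; rewrite /dTV ler_wpM2l ?invr_ge0 //.
pose C := (nsites R V * t) ^+ 2 + (nsites R V * (t' - t)) ^+ 2.
apply: (@ler_addinvn _ _ _ (3 * C)) => n.
pose eps i : R := if (i < n.+1)%N then t / n.+1%:R else (t' - t) / n.+1%:R.
have eps0 i : 0 <= eps i.
  by rewrite /eps; case: ifP => _; rewrite divr_ge0 ?subr_ge0.
have eps1 : forall F : R -> R, \sum_(i < n.+1) F (eps i) = \sum_(i < n.+1) F (t / n.+1%:R).
  by move=> F; apply: eq_bigr => i _; rewrite /eps ltn_ord.
have eps2 : forall F : R -> R, \sum_(i < n.+1) F (eps (n.+1 + i)%N) =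
   \sum_(i < n.+1) F ((t' - t) / n.+1%:R).
  by move=> F; apply: eq_bigr => i _; rewrite /eps ltnNge leq_addr.
have split (F : R -> R) : \sum_(i < (n.+1 + n.+1)%N) F (eps i) =
   \sum_(i < n.+1) F (t / n.+1%:R) + \sum_(i < n.+1) F ((t' - t) / n.+1%:R).
  by rewrite big_split_ord /= eps1 eps2.
have A := @law_chain s eps n.+1 eps0.
have B := @law_chain s eps (n.+1 + n.+1) eps0.
have D := chain_contracts e beta h eps0 n.+1 n.+1 s.
have D' : \sum_(i < n.+1) (1 - step_mass V (eps (n.+1 + i)%N)) <= C / n.+1%:R.
  apply: (@le_trans _ _ (\sum_(i < n.+1) (nsites R V * (eps (n.+1 + i)%N)) ^+ 2)).
    by apply: ler_sum => i _; rewrite lerBlDr -lerBlDl step_mass_ge.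
  rewrite (eps2 (fun x => (nsites R V * x) ^+ 2)) sum_sqr_div ler_wpM2r ?invr_ge0 //.
  by rewrite lerDr sqr_ge0.
move: A B; rewrite (eps1 id) sum_const_div (eps1 (fun x => (nsites R V * x) ^+ 2)) sum_sqr_div.
rewrite (split id) !sum_const_div (split (fun x => (nsites R V * x) ^+ 2)) !sum_sqr_div.
rewrite addrC subrK -mulrDl -/C => A B.
have A' : (nsites R V * t) ^+ 2 / n.+1%:R <= C / n.+1%:R.
  by rewrite ler_wpM2r ?invr_ge0 // lerDl sqr_ge0.
have tri1 : \sum_r `|law s t' r - mu r| <=
   \sum_r `|law s t' r - chain e beta h eps (n.+1 + n.+1) s r| +
   \sum_r `|chain e beta h eps (n.+1 + n.+1) s r - mu r|.
  by rewrite -big_split; apply: ler_sum => r _; exact: ler_distD.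
have tri2 : \sum_r `|chain e beta h eps n.+1 s r - mu r| <=
   \sum_r `|law s t r - chain e beta h eps n.+1 s r| +
   \sum_r `|law s t r - mu r|.
  by rewrite -big_split; apply: ler_sum => r _; rewrite (distrC (law s t r) (chain _ _ _ _ _ _ _)) ler_distD.
have comb (a b c d f g p k' k : R) : a <= b + c -> b <= k -> c <= d + g ->
    g <= k -> d <= p + f -> p <= k' -> k' <= k -> a <= f + 3 * k by lra.
by rewrite -mulrA; exact: comb tri1 B D D' tri2 A A'.
Qed.

Lemma law_exit (S : pred (config V)) (phi t : R) : 0 <= t ->
  \sum_(s | S s) mu s * \sum_v \sum_(r | ~~ S r) kernel e beta h v s r <= phi ->
  \sum_(s | S s) mu s * \sum_(r | ~~ S r) law s t r <= t * phi.
Proof.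
move=> t0 Sphi; apply: (@ler_addinvn _ _ _ ((nsites R V * t) ^+ 2)) => n.
have d0 (i : nat) : 0 <= t / n.+1%:R by rewrite divr_ge0.
have := chain_exit (eps := fun=> t / n.+1%:R) (d0) n.+1 Sphi.
rewrite sum_const_div => X.
apply: (@le_trans _ _ (\sum_(s | S s) mu s * \sum_(r | ~~ S r)
   chain e beta h (fun=> t / n.+1%:R) n.+1 s r + \sum_(s | S s) mu s *
   ((nsites R V * t) ^+ 2 / n.+1%:R))).
  rewrite -big_split /=; apply: ler_sum => s _; rewrite -mulrDr ler_wpM2l ?rfim_ge0 //.
  have := @law_chain s (fun=> t / n.+1%:R) n.+1 d0.
  rewrite sum_const_div sum_sqr_div => Y; rewrite -lerBlDl -sumrB.
  apply: le_trans Y; rewrite [leRHS](bigID S) /= addrC.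
  apply: ler_wpDr; first by apply: sumr_ge0.
  by apply: ler_sum => r _; exact: ler_norm.
apply: lerD => //; rewrite -mulr_suml ler_piMl //.
  by rewrite divr_ge0 // sqr_ge0.
rewrite -(sum_rfim e beta h) [leRHS](bigID S) /= lerDl sumr_ge0 // => r _.
exact: rfim_ge0.
Qed.

(** If all starting points are mixed at time t, each of them is out of S with
    probability at least 1/2 - 1/4; on the other hand the average exit
    probability from equilibrium in S is at most [t * phi]. *)
Lemma law_bottleneck (S : pred (config V)) (phi t : R) : 0 <= t ->
  (exists s, S s) -> \sum_(s | S s) mu s <= 2^-1 ->
  \sum_(s | S s) mu s * \sum_v \sum_(r | ~~ S r) kernel e beta h v s r
     <= phi * \sum_(s | S s) mu s ->
  (forall s, dTV (law s t) mu <= 4^-1) -> 1 <= 4 * (t * phi).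
Proof.
move=> t0 [s0 Ss0] half Sphi mixed.
have pos : 0 < \sum_(s | S s) mu s.
  rewrite (bigD1 s0) //= ltr_pwDl ?rfim_gt0 // sumr_ge0 // => r _; exact: rfim_ge0.
have out s : 4^-1 <= \sum_(r | ~~ S r) law s t r.
  have := @dTV_ge _ _ (law s t) mu (fun r => ~~ S r).
  rewrite law1 // sum_rfim => /(_ erefl) X; have Y := mixed s.
  have := sum_rfim e beta h; rewrite (bigID S) /=; lra.
have := law_exit t0 Sphi; rewrite mulrA => X.
have : (\sum_(s | S s) mu s) * 4^-1 <= t * phi * \sum_(s | S s) mu s.
  apply: le_trans X; rewrite mulr_suml; apply: ler_sum => s _.
  by rewrite ler_wpM2l ?rfim_ge0.
rewrite mulrC ler_pM2r //; lra.
Qed.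

End Semigroup.

(** * The law of continuous-time Glauber dynamics *)

Section RealProbability.
Variables (d : measure_display) (T : measurableType d) (R : realType).
Variable P : probability T R.

Definition prb (A : set T) : R := fine (P A).

Lemma prbE A : measurable A -> P A = (prb A)%:E.
Proof. by move=> mA; rewrite /prb fineK // fin_num_measure. Qed.

Lemma prb_ge0 A : 0 <= prb A.
Proof. exact: fine_ge0. Qed.

Lemma prbT : prb setT = 1. Proof. by rewrite /prb probability_setT. Qed.
Lemma prb0 : prb set0 = 0. Proof. by rewrite /prb measure0. Qed.

Lemma prbU A B : measurable A -> measurable B -> A `&` B = set0 ->
  prb (A `|` B) = prb A + prb B.
Proof.
move=> mA mB AB; apply: EFin_inj; rewrite EFinD -!prbE //; last exact: measurableU.
exact: measureU.
Qed.

Lemma prb_le A B : measurable A -> measurable B -> A `<=` B -> prb A <= prb B.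
Proof. by move=> mA mB AB; rewrite -lee_fin -!prbE // le_measure ?inE. Qed.

Lemma prbD A B : measurable A -> measurable B ->
  prb (A `&` ~` B) = prb A - prb (A `&` B).
Proof.
move=> mA mB; apply/eqP; rewrite eq_sym subr_eq addrC -prbU.
- by rewrite -setIUr setUv setIT.
- exact: measurableI.
- by apply: measurableI => //; exact: measurableC.
- by rewrite setIACA setICr setI0.
Qed.

Lemma prb_partition_seq (K : eqType) (f : T -> K) (s : seq K) A : measurable A ->
  (forall q, measurable [set w | f w = q]) -> uniq s ->
  measurable (A `&` [set w | f w \in s]) /\
  prb (A `&` [set w | f w \in s]) = \sum_(q <- s) prb (A `&` [set w | f w = q]).
Proof.
move=> mA mf; elim: s => [|q s IH] /=.
  have -> : [set w | f w \in [::]] = set0 by rewrite -subset0 => w.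
  by rewrite setI0 big_nil prb0.
move=> /andP[qs us]; have [mI Is] := IH us.
have -> : A `&` [set w | f w \in q :: s] =
  (A `&` [set w | f w = q]) `|` (A `&` [set w | f w \in s]).
  rewrite -setIUr; congr (_ `&` _); apply/seteqP; split=> w /=.
    by rewrite inE => /orP[/eqP|]; [left|right].
  by rewrite inE => -[->|->]; rewrite ?eqxx ?orbT.
have mq : measurable (A `&` [set w | f w = q]) by exact: measurableI.
split; first exact: measurableU.
rewrite big_cons -Is prbU //.
by rewrite -subset0 => w [[_ /= ->] [_ /=]]; rewrite (negbTE qs).
Qed.

Lemma prb_partition (K : finType) (f : T -> K) A : measurable A ->
  (forall q, measurable [set w | f w = q]) ->
  prb A = \sum_q prb (A `&` [set w | f w = q]).
Proof.
move=> mA mf; have [_] := prb_partition_seq mA mf (index_enum_uniq K).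
move=> <-; congr prb; rewrite (_ : [set _ | _] = setT) ?setIT //.
by apply/seteqP; split=> w //= _; rewrite mem_index_enum.
Qed.

Lemma prb_disjoint_le (K : eqType) (F : K -> set T) (s : seq K) B : uniq s ->
  measurable B -> (forall k, k \in s -> measurable (F k) /\ F k `<=` B) ->
  {in s &, forall k k', k != k' -> F k `&` F k' = set0} ->
  \sum_(k <- s) prb (F k) <= prb B.
Proof.
elim: s B => [|k s IH] B; first by rewrite big_nil prb_ge0.
move=> /= /andP[ks us] mB FB disj; rewrite big_cons.
have [mk kB] := FB k (mem_head _ _).
have mD : measurable (B `\` F k) by exact: measurableD.
rewrite -(setDUK kB) prbU //; last by rewrite setDIK.
rewrite lerD2l; apply: IH => //.
  move=> j js; have [mj jB] := FB j (mem_behead (s := k :: s) js); split=> // w wj.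
  split; first exact: jB.
  move=> wk; have jk : j != k by apply: contraNneq ks => <-.
  have : (F j `&` F k) w by [].
  by rewrite disj ?inE ?js ?eqxx ?orbT.
by move=> j j' js j's; apply: disj; rewrite inE ?js ?j's orbT.
Qed.

Lemma bigcap_seq_measurable (I : eqType) (J : seq I) (A : I -> set T) :
  (forall i, i \in J -> measurable (A i)) -> measurable (\bigcap_(i in [set` J]) A i).
Proof.
elim: J => [|i J IH] mA.
  by rewrite (_ : [set` _] = set0) ?bigcap_set0 // -subset0.
rewrite (_ : [set` _] = [set i] `|` [set` J]); last first.
  apply/seteqP; split=> j /=; rewrite inE.
    by move=> /orP[/eqP|]; [left|right].
  by move=> [->|->]; rewrite ?eqxx ?orbT.
rewrite bigcap_setU bigcap_set1; apply: measurableI.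
  by apply: mA; rewrite mem_head.
by apply: IH => j jJ; apply: mA; rewrite inE jJ orbT.
Qed.

Lemma independent_prb (I : eqType) (E : I -> set (set T)) (J : seq I) (A : I -> set T) :
  mutually_independent P E -> uniq J -> (forall i, E i `<=` measurable) ->
  (forall i, i \in J -> E i (A i)) ->
  prb (\bigcap_(i in [set` J]) A i) = \prod_(i <- J) prb (A i).
Proof.
move=> ind uJ mE EA; apply: EFin_inj.
rewrite -prbE; last by apply: bigcap_seq_measurable => i iJ; by apply: mE; exact: EA.
rewrite ind // -prodEFin; apply: eq_big_seq => i iJ.
by rewrite prbE //; by apply: mE; exact: EA.
Qed.

End RealProbability.

Section ProductEvents.
Variables (d : measure_display) (T : measurableType d) (R : realType).
Variables (P : probability T R) (I : eqType) (cls : I -> set (set T)).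
Hypothesis ind : mutually_independent P cls.
Hypothesis cls_measurable : forall i, cls i `<=` measurable.

(** An intersection of events with distinct indices, all in F.  Independence
    is used through this class only, because it is stable under intersection
    when the index sets are disjoint ([product_eventI]); this allows proofs by
    induction in which an independent remainder is carried along. *)
Definition product_event (F : pred I) (B : set T) :=
  exists J (A : I -> set T), [/\ uniq J, forall i, i \in J -> F i,
    forall i, i \in J -> cls i (A i) & B = \bigcap_(i in [set` J]) A i].

Lemma product_event_measurable (F : pred I) B : product_event F B -> measurable B.
Proof.
move=> [J [A [_ _ JA ->]]]; apply: bigcap_seq_measurable => i iJ.
by apply: cls_measurable; exact: JA.
Qed.

Lemma product_eventW (F F' : pred I) B : subpred F F' ->
  product_event F B -> product_event F' B.
Proof. by move=> FF' [J [A [uJ JF JA BE]]]; exists J, A; split=> // i /JF/FF'. Qed.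

Lemma product_event1 i A : cls i A -> product_event (pred1 i) A.
Proof.
move=> iA; exists [:: i], (fun=> A); split=> //.
- by move=> j; rewrite inE.
- by move=> j; rewrite inE => /eqP ->.
- apply/seteqP; split=> w wA; first by move=> j.
  by apply: (wA i); rewrite /= mem_head.
Qed.

Lemma product_eventI (F1 F2 : pred I) (B1 B2 : set T) : (forall i, F1 i -> F2 i -> False) ->
  product_event F1 B1 -> product_event F2 B2 ->
  product_event (predU F1 F2) (B1 `&` B2) /\ prb P (B1 `&` B2) = prb P B1 * prb P B2.
Proof.
move=> F12 [J1 [A1 [u1 JF1 JA1 ->]]] [J2 [A2 [u2 JF2 JA2 ->]]].
pose A i := if i \in J1 then A1 i else A2 i.
have n2 i : i \in J2 -> i \notin J1.
  by move=> i2; apply/negP => i1; exact: (F12 i (JF1 _ i1) (JF2 _ i2)).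
have uJ : uniq (J1 ++ J2).
  by rewrite cat_uniq u1 u2 andbT; apply/hasPn => i /n2.
have JA i : i \in J1 ++ J2 -> cls i (A i).
  rewrite mem_cat /A; have [i1 _|_ /= /JA2 //] := boolP (i \in J1).
  exact: JA1.
have BE : \bigcap_(i in [set` J1]) A1 i `&` \bigcap_(i in [set` J2]) A2 i =
   \bigcap_(i in [set` J1 ++ J2]) A i.
  apply/seteqP; split=> w.
    move=> [w1 w2] i /=; rewrite mem_cat /A.
    by case: ifP => [i1 _|_ /=]; [exact: w1|exact: w2].
  move=> wA; split=> i /= iJ; have := wA i; rewrite /= mem_cat /A.
    by rewrite iJ; apply.
  by rewrite iJ orbT (negbTE (n2 _ iJ)); apply.
split.
  exists (J1 ++ J2), A; split=> // i; rewrite mem_cat => /orP[/JF1|/JF2] /= ->;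
   by rewrite ?orbT.
rewrite BE !(independent_prb ind) ?big_cat //=; try exact: cls_measurable.
congr (_ * _); apply: eq_big_seq => i iJ; rewrite /A; first by rewrite iJ.
by rewrite (negbTE (n2 _ iJ)).
Qed.

End ProductEvents.

Lemma uniform_prob_le (R : realType) (p : R) : 0 <= p -> p <= 1 ->
  uniform_prob (@ltr01 R) [set x | x <= p] = p%:E.
Proof.
move=> p0 p1; rewrite /uniform_prob integral_uniform_pdf.
have -> : [set x | x <= p] `&` `[0, 1]%classic = `[0, p]%classic.
  apply/seteqP; split=> x /=; rewrite !in_itv /=.
    by move=> [-> /andP[->]].
  by move=> /andP[-> xp]; split=> //=; rewrite (le_trans xp).
rewrite (eq_integral (fun=> 1%:E)); last first.
  move=> x; rewrite inE /= in_itv /= => /andP[x0 xp].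
  by rewrite /uniform_pdf x0 (le_trans xp p1) subr0 invr1.
rewrite integral_cst //= mul1e lebesgue_measure_itv /= lte_fin.
case: ltP => [_|p0']; first by rewrite oppr0 adde0.
by congr EFin; apply/eqP; rewrite eq_le p0 p0'.
Qed.

Section Law.
Variables (R : realType) (V : finType) (e : rel V) (beta : R) (h : V -> R).
Variable G : glauber_dynamics e beta h.
Notation mu := (rfim e beta h).
Notation K := (kernel e beta h).
Let Om := gd_space G.
Let Pr : set Om -> R := prb (gd_prob G).
Let clock := @gd_clock _ _ _ _ _ G.
Let unif := @gd_unif _ _ _ _ _ G.
Let X := @gd_state _ _ _ _ _ G.

Lemma cond_plusE s v : cond_plus e beta h s v = K v s (set_spin s v true).
Proof. by rewrite /kernel agree_set_spin. Qed.

Let low s v : set R := [set x | x <= cond_plus e beta h s v].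

Lemma low_measurable s v : measurable (low s v).
Proof.
rewrite (_ : low s v = `]-oo, cond_plus e beta h s v]%classic) //.
Qed.

Lemma resample_preimage s v r : [set x : R | resample e beta h s v x = r] =
  (if set_spin s v true == r then low s v else set0) `|`
  (if set_spin s v false == r then ~` low s v else set0).
Proof.
apply/seteqP; split=> x; rewrite /resample /low /=.
  case: (boolP (x <= _)) => xc ->; [left|right]; rewrite eqxx //.
  exact/negP.
case; case: eqP => //= rE h1; rewrite -rE; congr set_spin; first exact: h1.
exact/negbTE/negP.
Qed.

Lemma resample_measurable s v r : measurable [set x : R | resample e beta h s v x = r].
Proof.
rewrite resample_preimage; apply: measurableU; case: ifP => // _.
  exact: low_measurable.
by apply: measurableC; exact: low_measurable.
Qed.

Lemma uniform_resample s v r :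
  uniform_prob (@ltr01 R) [set x : R | resample e beta h s v x = r] = (K v s r)%:E.
Proof.
have Ulow : uniform_prob (@ltr01 R) (low s v) = (K v s (set_spin s v true))%:E.
  by rewrite uniform_prob_le cond_plusE ?kernel_ge0 ?kernel_le1.
rewrite resample_preimage.
have [rt|rt] := eqVneq (set_spin s v true) r.
  rewrite -rt eq_sym (negbTE (set_spin_neq v s)) setU0 //.
have [rf|rf] := eqVneq (set_spin s v false) r.
  rewrite set0U -rf.
  transitivity (1 - uniform_prob (@ltr01 R) (low s v))%E.
    exact: (@probability_setC _ _ R (uniform_prob (@ltr01 R)) (low s v) (low_measurable s v)).
  rewrite Ulow -EFinB; congr EFin; rewrite -(sum_kernel e beta h v s).
  rewrite (bigID (agree v s)) /= kernel_sum_pair big1 ?addr0; first by ring.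
  by move=> q /negbTE sq; rewrite /kernel sq.
rewrite setU0 measure0 /kernel; case: ifP => // /agree_cases rE.
by move: rt rf; rewrite rE; case: (r v); rewrite eqxx.
Qed.

(** Discretisation of the graphical construction along the grid t.  On the
    event that each step of the grid sees at most one ring, the state is a
    function of the sequence of sites that ring and of the uniform variables
    used, all of which are independent. *)
Section Pattern.
Variable eps : nat -> R.
Hypothesis eps0 : forall i, 0 <= eps i.
Let t n := \sum_(i < n) eps i.

Lemma time0 : t 0 = 0. Proof. by rewrite /t big_ord0. Qed.
Lemma timeS n : t n.+1 = t n + eps n. Proof. by rewrite /t big_ord_recr. Qed.
Lemma time_ge0 n : 0 <= t n. Proof. exact: sumr_ge0. Qed.
Lemma time_step n : t n <= t n.+1. Proof. by rewrite timeS lerDl. Qed.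
Lemma time_nondecreasing : nondecreasing_seq t. Proof. exact/nondecreasing_seqP/time_step. Qed.

Let inc v j : Om -> nat := fun w => (clock v (t j.+1) w - clock v (t j) w)%N.
Let idx := ((V * nat) + (V * nat))%type.
Let cls (i : idx) : set (set Om) :=
  match i with inl vj => rv_events (inc vj.1 vj.2) | inr vk => rv_events (unif vk.1 vk.2) end.

Lemma cls_independent : mutually_independent (gd_prob G) cls.
Proof.
move=> J A uJ JA; apply: (gd_independent (g := G) (t := t)) => //.
- by rewrite time0.
- exact: time_nondecreasing.
- by move=> i iJ; have := JA i iJ; case: i iJ => -[v k].
Qed.

Lemma inc_measurable v j : measurable_fun setT (inc v j).
Proof. exact: measurable_realfun.measurable_fun_subn. Qed.

Lemma cls_measurable i : cls i `<=` measurable.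
Proof.
case: i => -[v k] A [B mB <-].
  by rewrite -[_ @^-1` _]setTI; exact: inc_measurable.
by rewrite /=; exact: measurable_funPTI.
Qed.

Lemma clsP_inc v j k : cls (inl (v, j)) [set w | inc v j w = k].
Proof. by exists [set k]. Qed.

Lemma clsP_unif v k s r :
  cls (inr (v, k)) [set w | resample e beta h s v (unif v k w) = r].
Proof. by exists [set x | resample e beta h s v x = r] => //; exact: resample_measurable. Qed.

Lemma Pr_inc v j (b : bool) :
  Pr [set w | inc v j w = b] = expR (- eps j) * (if b then eps j else 1).
Proof.
have := eps0 j; rewrite le_eqVlt => /orP[/eqP e0|e0].
  have i0 w : inc v j w = 0%N by rewrite /inc timeS -e0 addr0 subnn.
  rewrite -e0 oppr0 expR0 mul1r; case: b => /=.
    by rewrite (_ : [set w | _] = set0) /Pr ?prb0 // -subset0 => w /=; rewrite i0.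
  by rewrite (_ : [set w | _] = setT) /Pr ?prbT //; apply/seteqP; split=> w //=.
have tl : t j < t j.+1 by rewrite timeS ltrDl.
have te : t j.+1 - t j = eps j by rewrite timeS addrAC subrr add0r.
have := gd_clock_poisson G v b (time_ge0 j) tl; rewrite te /Pr /prb => ->.
rewrite /= /poisson_pmf e0; case: b; rewrite /= ?expr1 ?expr0 invr1; ring.
Qed.

Lemma Pr_unif v k s r :
  Pr [set w | resample e beta h s v (unif v k w) = r] = K v s r.
Proof.
have := gd_unif_uniform G v k (resample_measurable s v r).
by rewrite uniform_resample /Pr /prb /distribution /pushforward /preimage /= => ->.
Qed.

Definition rings n (a : option V) : set Om :=
  [set w | forall v, inc v n w = (a == Some v)].

Lemma rings_product n a :
  product_event cls (fun i => if i is inl vj then vj.2 == n else false) (rings n a) /\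
  Pr (rings n a) = expR (- (nsites R V * eps n)) * (if a is Some v then eps n else 1).
Proof.
pose J : seq idx := [seq inl (v, n) | v <- enum V].
pose A (i : idx) : set Om :=
  if i is inl vj then [set w | inc vj.1 vj.2 w = (a == Some vj.1)] else setT.
have uJ : uniq J by rewrite map_inj_uniq ?enum_uniq // => u v [].
have JA i : i \in J -> cls i (A i) by move=> /mapP[v _ ->]; exact: clsP_inc.
have BE : rings n a = \bigcap_(i in [set` J]) A i.
  apply/seteqP; split=> w wr; first by move=> i /= /mapP[v _ ->]; exact: wr.
  move=> v; apply: (wr (inl (v, n))) => /=.
  by apply/mapP; exists v => //; rewrite mem_enum.
split; first by exists J, A; split=> // i /mapP[v _ ->] /=.
rewrite BE /Pr (independent_prb cls_independent) //; last exact: cls_measurable.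
rewrite big_map /=; under eq_bigr do rewrite -/(Pr _) Pr_inc.
rewrite big_enum big_split /= prodr_const -expRM_natl mulrN; congr (_ * _).
case: a {A JA BE} => [v|]; last by rewrite big1.
rewrite (bigD1 v) //= eqxx big1 ?mulr1 // => u uv.
by rewrite (_ : _ == _ = false) //; apply/negbTE; apply: contra uv => /eqP[->].
Qed.

Definition ring_count (p : seq (option V)) v := count_mem (Some v) p.

(** Patterns are listed backwards in time: the head is the last step. *)
Fixpoint ring_pattern (p : seq (option V)) : set Om :=
  if p is a :: p' then ring_pattern p' `&` rings (size p') a else setT.

Lemma ring_pattern_count p w v : ring_pattern p w -> clock v (t (size p)) w = ring_count p v.
Proof.
elim: p => [_|a p IH] /=; first by rewrite time0; exact: gd_clock0.
move=> [/IH pw aw]; have := aw v; rewrite /inc pw /ring_count /= => h1.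
rewrite -h1 addnC subnKC // -/(ring_count p v) -pw.
by apply: (gd_clock_nondecreasing (g := G)); [exact: time_ge0|exact: time_step].
Qed.

Section Start.
Variable s : config V.

Fixpoint weight (p : seq (option V)) r : R :=
  match p with
  | [::] => (s == r)%:R
  | None :: p' => expR (- (nsites R V * eps (size p'))) * weight p' r
  | Some v :: p' => expR (- (nsites R V * eps (size p'))) *
      (eps (size p') * \sum_q weight p' q * K v q r)
  end.

Let path_to p r := ring_pattern p `&` [set w | X s (t (size p)) w = r].

(** The increments and uniform variables not yet used after the pattern p. *)
Definition fresh (p : seq (option V)) (i : idx) : bool :=
  match i with inl vj => (size p <= vj.2)%N | inr vk => (ring_count p vk.1 <= vk.2)%N end.

Lemma ring_pattern_measurable p : measurable (ring_pattern p).
Proof.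
elim: p => [|a p IH] //=; apply: measurableI => //.
by have [/(product_event_measurable cls_measurable)] := rings_product (size p) a.
Qed.

Lemma state_measurable n r : measurable [set w | X s (t n) w = r].
Proof. by apply: gd_measurable; exact: time_ge0. Qed.

Lemma path_measurable p r : measurable (path_to p r).
Proof.
apply: measurableI; [exact: ring_pattern_measurable|exact: state_measurable].
Qed.

Lemma state_none p w : ring_pattern (None :: p) w ->
  X s (t (size p).+1) w = X s (t (size p)) w.
Proof.
move=> [pw nw]; apply: (gd_no_ring (g := G)); [exact: time_ge0|exact: time_step|].
move=> v; have := nw v; rewrite /inc /= => /eqP; rewrite subn_eq0 => le1.
apply/eqP; rewrite eqn_leq; apply/andP; split; first exact: le1.
by apply: (gd_clock_nondecreasing (g := G)); [exact: time_ge0|exact: time_step].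
Qed.

Lemma state_some p v w : ring_pattern (Some v :: p) w ->
  X s (t (size p).+1) w =
  resample e beta h (X s (t (size p)) w) v (unif v (ring_count p v) w).
Proof.
move=> [pw nw]; rewrite -(ring_pattern_count v pw).
have mono u : (clock u (t (size p)) w <= clock u (t (size p).+1) w)%N.
  by apply: (gd_clock_nondecreasing (g := G)); [exact: time_ge0|exact: time_step].
apply: (gd_one_ring (g := G)); [exact: time_ge0|exact: time_step| |].
  by have := nw v; rewrite /inc eqxx /= => h1; rewrite -(subnKC (mono v)) h1 addn1.
move=> u uv; have := nw u; rewrite /inc (_ : (Some v == Some u) = false); last first.
  by apply/negbTE; apply: contra uv => /eqP[->].
by move=> h1; rewrite -(subnKC (mono u)) h1 addn0.
Qed.

(** The Markov property, in a form stable by induction on the pattern: the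
    factor B that depends on the future absorbs the increments and the uniform
    variable revealed by the last step. *)
Lemma path_weight p r B : product_event cls (fresh p) B ->
  Pr (path_to p r `&` B) = weight p r * Pr B.
Proof.
elim: p r B => [|a p IH] r B pB.
  rewrite /path_to /= setTI time0 /X.
  have [<-|sr] := eqVneq s r.
    rewrite mul1r (_ : [set w | _] = setT) ?setTI //.
    by apply/seteqP; split=> w //= _; exact: gd_init.
  rewrite mul0r (_ : [set w | _] = set0) ?set0I /Pr ?prb0 // -subset0 => w /=.
  by rewrite gd_init; apply/eqP.
have [pR PR] := rings_product (size p) a.
have freshS : subpred (fresh (a :: p)) (fresh p).
  case=> -[v k] /=; first exact: ltnW.
  by apply: leq_trans; rewrite /ring_count /= leq_addl.
case: a pB pR PR freshS => [v|] pB pR PR freshS.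
  pose k := ring_count p v.
  pose C q : set Om := [set w | resample e beta h q v (unif v k w) = r].
  have BC q : product_event cls (fresh p) (rings (size p) (Some v) `&` (C q `&` B)) /\
     Pr (rings (size p) (Some v) `&` (C q `&` B)) =
     expR (- (nsites R V * eps (size p))) * eps (size p) * (K v q r * Pr B).
    have [pCB PCB] := product_eventI cls_independent cls_measurable (F1 := pred1 (inr (v, k)))
       (F2 := fresh (Some v :: p)) (B1 := C q) (B2 := B)
       ltac:(by move=> i /eqP -> /=; rewrite /ring_count /= eqxx ltnn)
       (product_event1 (clsP_unif v k q r)) pB.
    have [pRCB PRCB] := product_eventI cls_independent cls_measurable (F1 := fun i => if i is inl vj then vj.2 == size p else false)
       (F2 := predU (pred1 (inr (v, k))) (fresh (Some v :: p)))
       (B1 := rings (size p) (Some v)) (B2 := C q `&` B)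
       ltac:(by case=> -[u j] //= /eqP ->; rewrite ltnn) pR pCB.
    split; last by rewrite /Pr PRCB PCB -!/(Pr _) PR Pr_unif.
    apply: product_eventW pRCB => i /=; case/or3P; last exact: freshS.
      by case: i => [[u j]|//] /= /eqP ->.
    by move=> /eqP -> /=.
  have PE : Pr (path_to (Some v :: p) r `&` B) =
     \sum_q Pr (path_to p q `&` (rings (size p) (Some v) `&` (C q `&` B))).
    rewrite /Pr (prb_partition _ (f := fun w => X s (t (size p)) w)); last first.
    - by move=> q; exact: state_measurable.
    - apply: measurableI; first exact: path_measurable.
      exact: (product_event_measurable cls_measurable) pB.
    apply: eq_bigr => q _; congr prb; apply/seteqP; split=> w.
      move=> [[[[pw nw] Xr] Bw] Xq]; do !split=> //.
      by rewrite /C /= -Xr -Xq /= (@state_some p v).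
    move=> [[pw Xq] [nw [Cw Bw]]]; do !split=> //.
    by rewrite /= (@state_some p v) // Xq.
  rewrite PE /=.
  under eq_bigr => q _ do rewrite (IH _ _ (BC q).1) (BC q).2.
  rewrite -!mulrA mulr_suml !mulr_sumr; apply: eq_bigr => q _; ring.
have [pRB PRB] := product_eventI cls_independent cls_measurable (F1 := fun i => if i is inl vj then vj.2 == size p else false)
   (F2 := fresh (None :: p)) (B1 := rings (size p) None) (B2 := B)
   ltac:(by case=> -[u j] //= /eqP ->; rewrite ltnn) pR pB.
have PE : path_to (None :: p) r `&` B = path_to p r `&` (rings (size p) None `&` B).
  apply/seteqP; split=> w.
    move=> [[[pw nw] Xr] Bw]; do !split=> //.
    by rewrite /= -(@state_none p w).
  move=> [[pw Xr] [nw Bw]]; do !split=> //.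
  by rewrite /= (@state_none p w).
rewrite PE IH; first by rewrite /Pr PRB -!/(Pr _) PR /=; ring.
apply: product_eventW pRB => i /=; case/orP; last exact: freshS.
by case: i => [[u j]|//] /= /eqP ->.
Qed.

Lemma path_prob p r : Pr (path_to p r) = weight p r.
Proof.
rewrite -[path_to p r]setIT path_weight /Pr ?prbT ?mulr1 //.
exists [::], (fun=> setT); split=> //.
by apply/seteqP; split=> // w _ i.
Qed.

Fixpoint patterns n : seq (seq (option V)) :=
  if n is n'.+1 then [seq a :: p | a <- None :: map Some (enum V), p <- patterns n'] else [:: [::]].

Lemma size_patterns n p : p \in patterns n -> size p = n.
Proof.
elim: n p => [|n IH] p; first by rewrite inE => /eqP ->.
by move=> /allpairsP[[a q] [_ /IH qn ->]] /=; rewrite qn.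
Qed.

Lemma uniq_patterns n : uniq (patterns n).
Proof.
elim: n => [|n IH] //; apply: allpairs_uniq => //=.
  rewrite map_inj_uniq ?enum_uniq ?andbT; last by move=> u v [].
  by apply/mapP => -[].
by move=> [a p] [b q] _ _ /= [-> ->].
Qed.

Lemma sum_weight n r : \sum_(p <- patterns n) weight p r = chain e beta h eps n s r.
Proof.
elim: n r => [|n IH] r; first by rewrite big_seq1.
rewrite big_allpairs_dep big_cons big_map big_enum /=.
rewrite /euler; under [RHS]eq_bigr do rewrite mulrCA mulrDr.
rewrite -mulr_sumr big_split /=; under [X in _ = _ * (X + _)]eq_bigr do rewrite mulrC eq_sym.
rewrite sum_deltal mulrDr -IH mulr_sumr; congr (_ + _).
  by apply: eq_big_seq => p pn; rewrite (size_patterns pn).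
transitivity (\sum_v expR (- (nsites R V * eps n)) *
    (eps n * \sum_q chain e beta h eps n s q * K v q r)); last first.
  rewrite -mulr_sumr; congr (_ * _); rewrite -mulr_sumr exchange_big /= mulr_sumr.
  by apply: eq_bigr => q _; rewrite -mulr_sumr mulrCA.
apply: eq_bigr => v _.
rewrite (eq_big_seq (fun p => expR (- (nsites R V * eps n)) *
   (eps n * \sum_q weight p q * K v q r))); last first.
  by move=> p pn; rewrite (size_patterns pn).
rewrite -!mulr_sumr exchange_big /=; congr (_ * (_ * _)).
by apply: eq_bigr => q _; rewrite -IH mulr_suml.
Qed.

(** The patterns are disjoint events, and the missing mass is the probability
    that some step sees two rings. *)
Lemma chain_le_law n r : chain e beta h eps n s r <= gd_law G s (t n) r.
Proof.
rewrite -sum_weight -[gd_law _ _ _ _]/(Pr [set w | X s (t n) w = r]).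
rewrite (eq_bigr (fun p => Pr (path_to p r))) => [|p _]; last by rewrite path_prob.
apply: prb_disjoint_le; first exact: uniq_patterns.
- exact: state_measurable.
- move=> p pn; split; first exact: path_measurable.
  by move=> w [_]; rewrite /= (size_patterns pn).
move=> p p' /size_patterns pn /size_patterns p'n pp'.
rewrite -subset0 => w [[pw _] [p'w _]]; move: pp'; apply/negP/negPn/eqP.
elim: n p p' pn p'n pw p'w => [|n IH] [|a p] [|b p'] //= [pn] [p'n] [pw aw] [p'w bw].
have pp' : p = p' by exact: IH.
congr (_ :: _) => //; subst p'.
have ab v : (a == Some v) = (b == Some v).
  by apply: (can_inj oddb); rewrite -aw -bw.
case: a b ab {aw bw} => [u|] [v|] // ab.
- by have := ab u; rewrite eqxx => /esym/eqP.
- by have := ab u; rewrite eqxx.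
- by have := ab v; rewrite eqxx.
Qed.

End Start.
End Pattern.

Lemma sum_gd_law s (a : R) : 0 <= a -> \sum_r gd_law G s a r = 1.
Proof.
move=> a0; rewrite -[RHS](prbT (gd_prob G)).
rewrite [RHS](prb_partition _ (f := fun w => @gd_state _ _ _ _ _ G s a w)) //; last first.
  by move=> q; exact: gd_measurable.
by apply: eq_bigr => r _; rewrite setTI.
Qed.

Lemma gd_law_ge s (eps : nat -> R) n r : (forall i, 0 <= eps i) ->
  chain e beta h eps n s r <= gd_law G s (\sum_(i < n) eps i) r.
Proof. by move=> eps0; exact: chain_le_law. Qed.

End Law.

(** * Mixing time: monotonicity, bottleneck bound, measurability *)

Section MixingTime.
Variables (R : realType) (V : finType) (e : rel V) (beta : R) (h : V -> R).
Variable G : glauber_dynamics e beta h.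
Notation mu := (rfim e beta h).

Definition mixed (t : R) := forall s, dTV (gd_law G s t) mu <= 4^-1.

Lemma mixing_time_geP (c : R) :
  (c%:E <= mixing_time G)%E <-> forall t, 0 <= t -> mixed t -> c <= t.
Proof.
have mixedP t : \big[Num.max/0]_(s : config V) dTV (gd_law G s t) mu <= 4^-1 <-> mixed t.
  split=> [/bigmax_leP[_ H] s|H]; first exact: H.
  by apply/bigmax_leP; split=> //; rewrite invr_ge0.
split=> [cm t t0 /mixedP mt|H].
  rewrite -lee_fin; apply: le_trans cm _; apply: ereal_inf_lbound.
  by exists t.
apply: le_ereal_inf_tmp => _ [t [t0 /mixedP mt] <-]; rewrite lee_fin; exact: H.
Qed.

Lemma mixed_mono t t' : 0 <= t -> t <= t' -> mixed t -> mixed t'.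
Proof.
move=> t0 tt' mt s; apply: le_trans (mt s).
apply: (dTV_law_noninc _ _ _ t0 tt').
  by move=> r a a0; exact: sum_gd_law.
by move=> r eps n q eps0; exact: gd_law_ge.
Qed.

(** As being mixed is a monotone property of time, countably many times
    approaching c from below are enough; measurability rests on this. *)
Lemma mixing_time_seqP (c : R) : 0 < c ->
  (c%:E <= mixing_time G)%E <-> forall k : nat, ~ mixed (c * (1 - k.+1%:R^-1)).
Proof.
move=> c0; rewrite mixing_time_geP; split=> [H k mk|H t t0 mt].
  have p0 : 0 <= c * (1 - k.+1%:R^-1).
    by rewrite mulr_ge0 ?(ltW c0) // subr_ge0 invf_le1 // ler1n.
  have := H _ p0 mk; rewrite -{1}[c]mulr1 ler_pM2l // lerDl oppr_ge0.
  by rewrite leNgt invr_gt0 ltr0n.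
rewrite leNgt; apply/negP => tc.
pose k := Num.truncn (c / (c - t)).
apply: (H k); apply: mixed_mono mt => //.
have ct : 0 < c - t by rewrite subr_gt0.
have : c / (c - t) < k.+1%:R by rewrite truncnS_gt.
rewrite ltr_pdivrMr // => h1.
have k0 : 0 < k.+1%:R :> R by [].
have h2 : c / k.+1%:R <= c - t by rewrite ler_pdivrMr // mulrC ltW.
by rewrite mulrBr mulr1 lerBrDr [t + _]addrC -lerBrDr; exact: h2.
Qed.

Lemma mixing_bottleneck (S : pred (config V)) (phi c : R) : 
  (exists s, S s) -> \sum_(s | S s) mu s <= 2^-1 ->
  \sum_(s | S s) mu s * \sum_v \sum_(r | ~~ S r) kernel e beta h v s r
     <= phi * \sum_(s | S s) mu s ->
  0 <= phi -> 4 * (c * phi) <= 1 -> (c%:E <= mixing_time G)%E.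
Proof.
move=> exS half Sphi phi0 cphi; apply/mixing_time_geP => t t0 mt.
have := law_bottleneck _ _ t0 exS half Sphi mt.
move=> /(_ (fun s a a0 => sum_gd_law G s a0)).
move=> /(_ (fun s eps n r eps0 => gd_law_ge G s n r eps0)) tphi.
have phi1 : 0 < phi.
  by rewrite lt_neqAle phi0 andbT; apply: contraTneq tphi => <-; rewrite -ltNge; lra.
rewrite -(ler_pM2r phi1); lra.
Qed.

End MixingTime.

Section Measurability.
Variables (d : measure_display) (T : measurableType d) (R : realType).
Variables (V : finType) (e : rel V) (beta : R) (h : V -> T -> R).
Hypothesis h_measurable : forall v, measurable_fun setT (h v).
Notation H w := (fun v => h v w).

Lemma measurable_funV (f : T -> R) : measurable_fun setT f -> (forall w, 0 <= f w) ->
  measurable_fun setT (fun w => (f w)^-1).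
Proof.
move=> mf f0; rewrite (_ : (fun w => _) = (fun x => powR x (-1)) \o f); last first.
  by apply/funext => w /=; rewrite powR_inv1.
by apply: measurableT_comp => //; exact: measurable_powR.
Qed.

Lemma measurable_rfim s : measurable_fun setT (fun w => rfim e beta (H w) s).
Proof.
have mx r : measurable_fun setT (fun w => expR (rfim_exponent e beta (H w) r)).
  apply: measurableT_comp; first exact: measurable_expR.
  apply: measurable_funD; first exact: measurable_cst.
  apply: measurable_sum => v; apply: measurable_funM => //; exact: measurable_cst.
apply: measurable_funM => //; apply: measurable_funV.
  by apply: measurable_sum => r; exact: mx.
by move=> w; apply: sumr_ge0 => r _; exact: expR_ge0.
Qed.

Lemma measurable_kernel v s r : measurable_fun setT (fun w => kernel e beta (H w) v s r).
Proof.
rewrite /kernel; case: agree; last exact: measurable_cst.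
apply: measurable_funM; first exact: measurable_rfim.
apply: measurable_funV; first by apply: measurable_funD; exact: measurable_rfim.
by move=> w; rewrite addr_ge0 // rfim_ge0.
Qed.

Lemma measurable_chain (eps : nat -> R) n s r :
  measurable_fun setT (fun w => chain e beta (H w) eps n s r).
Proof.
elim: n r => [|n IH] r /=; first exact: measurable_cst.
apply: measurable_sum => q; apply: measurable_funM => //.
apply: measurable_funM; first exact: measurable_cst.
apply: measurable_funD; first exact: measurable_cst.
apply: measurable_funM; first exact: measurable_cst.
by apply: measurable_sum => v; exact: measurable_kernel.
Qed.

Variable G : forall w, glauber_dynamics e beta (H w).

(** The dynamics is an arbitrary function of the disorder, but its law is the
    limit of the Euler schemes, which depend measurably on the field. *)
Lemma measurable_gd_law s (t : R) r : 0 <= t ->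
  measurable_fun setT (fun w => gd_law (G w) s t r).
Proof.
move=> t0; apply: (@measurable_fun_cvg _ _ _ _
  (fun n w => chain e beta (H w) (fun=> t / n.+1%:R) n.+1 s r)).
  by move=> n; exact: measurable_chain.
move=> w _.
have bnd n : `|gd_law (G w) s t r - chain e beta (H w) (fun=> t / n.+1%:R) n.+1 s r|
   <= (nsites R V * t) ^+ 2 / n.+1%:R.
  have d0 (i : nat) : 0 <= t / n.+1%:R by rewrite divr_ge0.
  have := law_chain (fun s a a0 => sum_gd_law (G w) s a0)
    (fun s eps n r eps0 => gd_law_ge (G w) s n r eps0) s n.+1 d0.
  rewrite sum_const_div sum_sqr_div; apply: le_trans.
  by rewrite (bigD1 r) //= lerDl sumr_ge0.
apply/cvgrPdist_le => eps eps0.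
have [N _ HN] : \forall n \near \oo, (nsites R V * t) ^+ 2 / n.+1%:R <= eps.
  pose C := (nsites R V * t) ^+ 2.
  exists (Num.truncn (C / eps)) => // n /= Nn.
  rewrite ler_pdivrMr // [eps * _]mulrC -ler_pdivrMr //.
  by apply/ltW/(lt_le_trans (truncnS_gt _)); rewrite ler_nat ltnS.
by exists N => // n Nn; apply: le_trans (bnd n) _; exact: HN.
Qed.

Lemma measurable_mixed (t : R) : 0 <= t -> measurable [set w | mixed (G w) t].
Proof.
move=> t0.
rewrite (_ : [set w | _] = \bigcap_(s in [set` enum {: config V}])
  [set w | dTV (gd_law (G w) s t) (rfim e beta (H w)) <= 4^-1]); last first.
  apply/seteqP; split=> w mw s; first by move=> _; exact: mw.
  by apply: mw; rewrite /= mem_enum.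
apply: bigcap_seq_measurable => s _.
have mf : measurable_fun setT (fun w => dTV (gd_law (G w) s t) (rfim e beta (H w))).
  apply: measurable_funM; first exact: measurable_cst.
  apply: measurable_sum => r; apply: measurableT_comp; first exact: normr_measurable.
  apply: measurable_funB; first exact: measurable_gd_law.
  exact: measurable_rfim.
have := mf measurableT `]-oo, 4^-1]%classic.
rewrite setTI (_ : _ @^-1` _ = [set w | dTV (gd_law (G w) s t) (rfim e beta (H w)) <= 4^-1]).
  by apply; exact: measurable_itv.
by apply/seteqP; split=> w /=; rewrite in_itv.
Qed.

Lemma measurable_mixing_time_ge (c : R) : 0 < c ->
  measurable [set w | (c%:E <= mixing_time (G w))%E].
Proof.
move=> c0.
rewrite (_ : [set w | _] = \bigcap_(k in [set: nat])
  ~` [set w | mixed (G w) (c * (1 - k.+1%:R^-1))]); last first.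
  apply/seteqP; split=> w /=; first by move=> /(mixing_time_seqP _ c0) cm k _; exact: cm.
  by move=> cm; apply/(mixing_time_seqP _ c0) => k; exact: cm.
apply: bigcapT_measurable => k; apply: measurableC; apply: measurable_mixed.
by rewrite mulr_ge0 ?(ltW c0) // subr_ge0 invf_le1 // ler1n.
Qed.
End Measurability.

(** * Metastability of an isolated square in a frozen shell *)

Section EnergyDifference.
Variables (R : realType) (V : finType) (e : rel V) (beta : R) (h : V -> R).
Hypothesis e_sym : symmetric e.
Notation mu := (rfim e beta h).
Implicit Types (s : config V) (W : {set V}).

Definition flip_on s W : config V := [ffun u => s u (+) (u \in W)].

Lemma spin_flip (b c : bool) : spin R (b (+) c) = (1 - 2 * c%:R) * spin R b.
Proof. by case: b c => [] []; rewrite /spin /=; ring. Qed.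

(** Only the pairs with exactly one endpoint in W and the fields in W change
    sign. *)
Lemma rfim_exponent_flip s W :
  rfim_exponent e beta h (flip_on s W) = rfim_exponent e beta h s
   - 2 * (beta * \sum_(u in W) \sum_(v | e u v && (v \notin W)) spin R (s u) * spin R (s v)
          + \sum_(u in W) h u * spin R (s u)).
Proof.
pose A u v := (u \in W)%:R * (v \notin W)%:R * (spin R (s u) * spin R (s v)).
have one u v : spin R (flip_on s W u) * spin R (flip_on s W v) =
   spin R (s u) * spin R (s v) - 2 * (A u v + A v u).
  rewrite !ffunE !spin_flip /A; case: (u \in W); case: (v \in W) => /=; ring.
have AE : \sum_u \sum_(v | e u v) A u v =
  \sum_(u in W) \sum_(v | e u v && (v \notin W)) spin R (s u) * spin R (s v).
  rewrite [RHS]big_mkcond /=; apply: eq_bigr => u _; rewrite /A.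
  case: (u \in W); last by rewrite big1 // => v _; rewrite !mul0r.
  rewrite [RHS]big_mkcondr; apply: eq_bigr => v _; rewrite mul1r.
  by case: (v \in W); rewrite /= ?mul0r ?mul1r.
have AE' : \sum_u \sum_(v | e u v) A v u = \sum_u \sum_(v | e u v) A u v.
  rewrite (exchange_big_dep xpredT) //=; apply: eq_bigr => v _.
  by apply: eq_bigl => u; rewrite e_sym.
have pairs : \sum_u \sum_(v | e u v) spin R (flip_on s W u) * spin R (flip_on s W v) =
  \sum_u \sum_(v | e u v) spin R (s u) * spin R (s v) - 4 * \sum_u \sum_(v | e u v) A u v.
  transitivity (\sum_u \sum_(v | e u v) spin R (s u) * spin R (s v) -
     2 * (\sum_u \sum_(v | e u v) A u v + \sum_u \sum_(v | e u v) A v u)).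
    rewrite -big_split /= mulr_sumr -sumrB; apply: eq_bigr => u _.
    rewrite -big_split /= mulr_sumr -sumrB; apply: eq_bigr => v _; exact: one.
  rewrite AE'; ring.
have fields : \sum_u h u * spin R (flip_on s W u) =
  \sum_u h u * spin R (s u) - 2 * \sum_(u in W) h u * spin R (s u).
  rewrite [in X in _ - 2 * X]big_mkcond mulr_sumr -sumrB; apply: eq_bigr => u _.
  rewrite ffunE spin_flip; case: (u \in W) => /=; ring.
rewrite /rfim_exponent pairs fields AE; by field.
Qed.

Lemma rfim_ratio s W (x : R) :
  x <= rfim_exponent e beta h (flip_on s W) - rfim_exponent e beta h s ->
  mu s <= expR (- x) * mu (flip_on s W).
Proof.
move=> dx; rewrite /rfim [leRHS]mulrA ler_wpM2r //.
  by rewrite invr_ge0 sumr_ge0 // => r _; exact: expR_ge0.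
by rewrite -expRD ler_expR; lra.
Qed.

(** A spin aligned with a large field h v flips with probability at most
    exp(- 2 h v), up to the force exerted by its D neighbours. *)
Lemma kernel_flip_field v s (D : nat) : 0 <= beta -> s v ->
  (#|[set u | e v u]%SET| <= D)%N ->
  kernel e beta h v s (flip_at s v) <= expR (- (2 * h v) + 2 * (beta * D%:R)).
Proof.
move=> b0 sv deg; apply: le_trans (kernel_flip_le _ _ _ _ _) _.
rewrite ler_pdivrMr ?rfim_gt0 //.
have -> : flip_at s v = flip_on s [set v]%SET.
  apply/ffunP => u; rewrite !ffunE finset.in_set1; case: eqVneq => [->|]; last by rewrite addbF.
  by rewrite addbT.
rewrite /rfim [leRHS]mulrA ler_wpM2r //.
  by rewrite invr_ge0 sumr_ge0 // => r _; exact: expR_ge0.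
rewrite -expRD ler_expR rfim_exponent_flip !big_set1 sv {2}/spin mulr1.
set Q := \sum_(_ | _) _.
have : - D%:R <= Q.
  apply: (@le_trans _ _ (- #|[set u | e v u]%SET|%:R)); first by rewrite lerN2 ler_nat.
  rewrite -sum1_card natr_sum -sumrN /Q [leRHS]big_mkcondr /=.
  rewrite (eq_bigl (fun u => e v u)); last by move=> u; rewrite inE.
  apply: ler_sum => u _; case: ifP => _; last by lra.
  by rewrite /spin; case: (s u); lra.
move=> QD; have := ler_wpM2l b0 QD; lra.
Qed.

End EnergyDifference.

(** The graph V contains a square grid, embedded by iota, whose other
    neighbours form the shell.  The field in the shell is at least M.  On the
    grid it compensates the force of the shell up to delta, so that with a +1
    shell the grid is an Ising model in an almost zero field with free boundary
    condition. *)
Section Trap.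
Variables (R : realType) (V : finType) (e : rel V) (beta : R) (h : V -> R).
Hypothesis e_sym : symmetric e.
Variables (l k m : nat) (iota : grid l -> V) (shell : {set V}) (D : nat) (delta M : R).
Hypothesis iota_inj : injective iota.
Hypothesis e_iota : forall x y, e (iota x) (iota y) =
  [exists b, bond_to (b, x) y || bond_to (b, y) x].
Hypothesis shell_iota : forall x, iota x \notin shell.
Hypothesis iota_shell : forall x v, e (iota x) v -> v \notin codom iota -> v \in shell.
Hypothesis degree : forall v, (#|[set u | e v u]%SET| <= D)%N.
Hypothesis beta_ge : 10 <= beta.

Definition outer_degree x := #|[set v | e (iota x) v && (v \notin codom iota)]%SET|.

Hypothesis field_grid : forall x, 0 <= h (iota x) + beta * (outer_degree x)%:R <= delta.
Hypothesis field_shell : forall v, v \in shell -> M <= h v.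
Hypothesis delta_small : 2 * (delta * (l.+1 ^ 2)%:R) <= 1.
Hypothesis mk : (18 + 324 * m <= k)%N.
Hypothesis kl : (k <= l)%N.
Hypothesis kk : (648 * k ^ 2 + 1 < l.+1 ^ 2)%N.

Notation mu := (rfim e beta h).
Implicit Types (s : config V) (c : bool).

Let rest s : grid l -> bool := fun x => s (iota x).

Definition phase c : pred (config V) :=
  fun s => [forall v in shell, s v] && `[< in_phase k c (rest s) >].

Lemma phaseP c s : reflect ((forall v, v \in shell -> s v) /\ in_phase k c (rest s)) (phase c s).
Proof.
apply: (iffP andP) => -[sh gd]; split.
- by move=> v vs; move/forall_inP: sh => /(_ v vs).
- exact/asboolP.
- exact/forall_inP.
- exact/asboolP.
Qed.

Let beta0 : 0 <= beta. Proof. by move: beta_ge; lra. Qed.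

Section Remove.
Variables (s : config V) (c : bool) (g : {set bond l}).
Hypothesis sc : phase c s.
Hypothesis gs : g \in clusters (@touch l) (disagreements (rest s)).
Let I := filling k g.
Let W : {set V} := [set iota x | x in I]%SET.

Let memW x : (iota x \in W) = (x \in I).
Proof. exact: mem_imset. Qed.

Lemma rest_remove : rest (flip_on s W) = fun x => rest s x (+) (x \in I).
Proof. by apply/funext => x; rewrite /rest ffunE memW. Qed.

Lemma phase_remove : phase c (flip_on s W).
Proof.
have [sh gd] := phaseP _ _ sc; apply/phaseP; split.
  move=> v vs; rewrite ffunE sh //; apply/negP => /imsetP[x _ vx].
  by move: vs; rewrite vx; apply/negP/shell_iota.
by rewrite rest_remove; apply: in_phase_remove.
Qed.

Let gap := [set p : grid l * grid l | [&& p.1 \in I, p.2 \notin I & e (iota p.1) (iota p.2)]]%SET.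

Lemma disagreements_I : disagreements (fun x => x \in I) = g.
Proof.
by have [_ [sm _]] := phaseP _ _ sc; apply: (disagreements_filling kl gs); apply: sm.
Qed.

Lemma gap_disagree p : p \in gap -> rest s p.1 != rest s p.2.
Proof.
rewrite inE e_iota => /and3P[p1 p2 /existsP[b]].
have sub := fintype.subsetP (clusters_sub gs).
case/orP => pb.
  have : (b, p.1) \in g by rewrite -disagreements_I (disagreementsE _ pb) /= p1 (negbTE p2).
  by move=> /sub; rewrite (disagreementsE _ pb) /=; case: (rest s _) (rest s _) => [] [].
have : (b, p.2) \in g by rewrite -disagreements_I (disagreementsE _ pb) /= p1 (negbTE p2).
by move=> /sub; rewrite (disagreementsE _ pb) /=; case: (rest s _) (rest s _) => [] [].
Qed.

(** [F] recovers a bond of g from the ordered pair of its endpoints, the one in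
    I first. *)
Lemma card_gap : (#|g| <= #|gap|)%N.
Proof.
pose F (p : grid l * grid l) : bond l :=
  if bond_to (false, p.1) p.2 then (false, p.1) else
  if bond_to (true, p.1) p.2 then (true, p.1) else
  if bond_to (false, p.2) p.1 then (false, p.2) else (true, p.2).
apply: leq_trans (leq_imset_card F gap); apply: subset_leq_card.
apply/fintype.subsetP => -[b z] gz; have := gz; rewrite -disagreements_I => /disagreementsP[y zy].
have adj : e (iota z) (iota y) by rewrite e_iota; apply/existsP; exists b; rewrite zy.
have := gz; rewrite -disagreements_I (disagreementsE _ zy) /=.
have [zI|zI] := boolP (z \in I); have [yI|yI] := boolP (y \in I) => //= _.
  apply/imsetP; exists (z, y); first by rewrite inE /= zI yI adj.
  rewrite /F /=; case: b zy {gz} => [zy|-> //]; rewrite zy.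
  by case: ifP => // /bond_to_dir; rewrite -(bond_to_dir zy).
apply/imsetP; exists (y, z); first by rewrite inE /= zI yI e_sym adj.
have no b' : bond_to (b', y) z = false.
  by apply/negP => /bond_to_sum; have := bond_to_sum zy; rewrite /=; clear; lia.
rewrite /F /= !no; case: b zy {gz} => [zy|-> //].
by case: ifP => // /bond_to_dir; rewrite -(bond_to_dir zy).
Qed.

(** Flipping the filling of a contour g turns the |g| disagreements along g
    into agreements.  The interaction with the shell and the field nearly
    cancel; over the whole grid they contribute at most 1. *)
Lemma exponent_remove : 2 * (beta * #|g|%:R) - 1 <=
  rfim_exponent e beta h (flip_on s W) - rfim_exponent e beta h s.
Proof.
have [sh _] := phaseP _ _ sc.
rewrite (rfim_exponent_flip _ _ e_sym) addrAC subrr add0r.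
rewrite !big_imset /=; try by move=> x y _ _; exact: iota_inj.
pose a x := spin R (s (iota x)).
have inner x : x \in I ->
  \sum_(v | e (iota x) v && (v \notin W)) a x * spin R (s v) =
  a x * (outer_degree x)%:R - (\sum_(y | (x, y) \in gap) 1).
  move=> xI; rewrite (bigID (fun v => v \in codom iota)) /= addrC; congr (_ + _).
    rewrite -mulr_sumr; congr (_ * _).
    rewrite /outer_degree -sum1_card natr_sum; apply: eq_big => v.
      rewrite inE; case: (e _ v) => //=; case: (boolP (v \in codom iota)) => //= vi.
        by rewrite andbF.
      by rewrite andbT; apply/imsetP => -[y _ vy]; move: vi; rewrite vy codom_f.
    by move=> /andP[/andP[ev vW] vc]; rewrite sh // (iota_shell ev).
  rewrite -sumrN.
  rewrite (reindex_omap iota (fun v => [pick y | iota y == v])) /=; last first.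
    move=> v /andP[_ /codomP[y ->]]; case: pickP => [z /eqP zy|/(_ y)]; first by rewrite /= zy.
    by rewrite eqxx.
  apply: eq_big => y.
    have -> : [pick z | iota z == iota y] = Some y.
      by case: pickP => [z /eqP/iota_inj ->|/(_ y)]; rewrite ?eqxx.
    by rewrite eqxx andbT codom_f andbT memW inE /= xI /= andbC.
  move=> /andP[/andP[/andP[exy yW] _] _].
  have /gap_disagree : (x, y) \in gap by rewrite inE /= xI exy -memW yW.
  by rewrite /a /rest /=; case: (s _) (s _) => [] []; rewrite /spin //=; lra.
under eq_bigr => x xI do rewrite (inner x xI).
rewrite big_split /= sumrN.
have -> : \sum_(x in I) \sum_(y | (x, y) \in gap) (1 : R) = #|gap|%:R.
  rewrite pair_big_dep /= -sum1_card natr_sum; apply: eq_bigl => -[x y] /=.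
  by rewrite !inE /=; case: (x \in I).
have hb x : x \in I -> a x * (beta * (outer_degree x)%:R + h (iota x)) <= delta.
  move=> _; have /andP[] := field_grid x; rewrite /a; case: (s _); rewrite /spin; lra.
have : \sum_(x in I) a x * (beta * (outer_degree x)%:R + h (iota x)) <= delta * (l.+1 ^ 2)%:R.
  apply: le_trans (ler_sum _ hb) _; rewrite sumr_const -[delta *+ _]mulr_natr.
  have d0 : 0 <= delta by have /andP[] := field_grid (mkg l 0 0); lra.
  rewrite ler_wpM2l // ler_nat; apply: leq_trans (max_card _) _.
  by rewrite card_prod !card_ord mulnn.
have -> : \sum_(x in I) a x * (beta * (outer_degree x)%:R + h (iota x)) =
   beta * \sum_(x in I) a x * (outer_degree x)%:R + \sum_(x in I) h (iota x) * a x.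
  rewrite mulr_sumr -big_split /=; apply: eq_bigr => x _; ring.
have := ler_wpM2l beta0 (_ : #|g|%:R <= #|gap|%:R :> R); rewrite ler_nat => /(_ card_gap).
by rewrite /a mulrBr; move: delta_small; lra.
Qed.

Lemma rfim_remove : mu s <= expR (1 - 2 * (beta * #|g|%:R)) * mu (flip_on s W).
Proof.
have := rfim_ratio exponent_remove.
by rewrite opprB.
Qed.

End Remove.

Let contours s := clusters (@touch l) (disagreements (rest s)).

Lemma flip_onK W : involutive (fun s => flip_on s W).
Proof. by move=> s; apply/ffunP => u; rewrite !ffunE -addbA addbb addbF. Qed.

(** For a fixed g, erasing g is an involution of configurations that maps this
    event into the phase. *)
Lemma peierls_contour c (g : {set bond l}) :
  \sum_(s | phase c s && (g \in contours s)) mu s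
    <= expR (1 - 2 * (beta * #|g|%:R)) * \sum_(s | phase c s) mu s.
Proof.
pose W : {set V} := [set iota x | x in filling k g]%SET.
rewrite (reindex_inj (inv_inj (flip_onK W)) (P := phase c)) mulr_sumr /=.
rewrite big_mkcond [leRHS]big_mkcond; apply: ler_sum => s _.
case: ifP => [/andP[sc gs]|_].
  by rewrite (phase_remove sc gs) (rfim_remove sc gs).
by case: ifP => // _; rewrite mulr_ge0 ?expR_ge0 // rfim_ge0.
Qed.

(** Some contour is too long for [in_phase_flip] to apply. *)
Definition rough s := [exists g in contours s, (m < #|g|)%N].

(** As beta is at least 10, exp(- 2 beta n) is at most exp(- 2 n) exp(- 18 n),
    and the last factor pays for the entropy 2^(18 n) of contours. *)
Lemma expR_contour (n : nat) : (m < n)%N ->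
  expR (1 - 2 * (beta * n%:R)) <= expR (1 - 2 * m%:R) * 2^-1 ^+ (18 * n) :> R.
Proof.
move=> mn; have nm : (m%:R : R) <= n%:R by rewrite ler_nat ltnW.
apply: (@le_trans _ _ (expR (1 - 2 * m%:R) * expR (- (18 * n)%:R))).
  rewrite -expRD ler_expR natrM.
  have := ler_wpM2r (ler0n R n) beta_ge; lra.
rewrite ler_wpM2l ?expR_ge0 // expRN exprVn lef_pV2 ?posrE ?expR_gt0 ?exprn_gt0 //.
rewrite -[X in expR X]mulr1 expRM_natl lerXn2r ?nnegrE ?expR_ge0 //.
by have := expR_ge1Dx (1 : R); lra.
Qed.

(** Union bound over the contours longer than m; there are 2 (l + 1)^2 choices
    of a bond in the contour. *)
Lemma peierls c : \sum_(s | phase c s && rough s) mu s <=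
  (2 * l.+1 ^ 2)%:R * expR (1 - 2 * m%:R) * \sum_(s | phase c s) mu s.
Proof.
set Z := \sum_(s | phase c s) mu s.
have Z0 : 0 <= Z by apply: sumr_ge0 => s _; exact: rfim_ge0.
pose long (g : {set bond l}) := is_cluster (@touch l) g && (m < #|g|)%N.
apply: (@le_trans _ _ (\sum_(g | long g) \sum_(s | phase c s && (g \in contours s)) mu s)).
  rewrite (exchange_big_dep (phase c)) /=; last by move=> g s _ /andP[].
  rewrite big_mkcondr; apply: ler_sum => s sc; case: ifP => [|_]; last first.
    by apply: sumr_ge0 => g _; exact: rfim_ge0.
  move=> /exists_inP[g gs mg]; rewrite (bigD1 g) /=; last first.
    by rewrite /long mg sc gs (clusters_is_cluster (@touch_sym l) gs).
  by rewrite lerDl; apply: sumr_ge0 => g' _; exact: rfim_ge0.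
apply: (@le_trans _ _ (\sum_(g | long g) expR (1 - 2 * m%:R) * 2^-1 ^+ (18 * #|g|) * Z)).
  apply: ler_sum => g /andP[_ mg]; apply: le_trans (peierls_contour c g) _.
  by rewrite ler_wpM2r // expR_contour.
rewrite -mulr_suml ler_wpM2r // -mulr_sumr [leRHS]mulrC ler_wpM2l ?expR_ge0 //.
apply: (@le_trans _ _ (\sum_(b : bond l)
   \sum_(g : {set bond l} | is_cluster (@touch l) g && (b \in g)) (2^-1 : R) ^+ (18 * #|g|))).
  rewrite (exchange_big_dep (is_cluster (@touch l))) /=; last by move=> b g _ /andP[].
  rewrite big_mkcondr; apply: ler_sum => g gc; case: ifP => [_|_].
    have [b bg] := clusters_n0 gc.
    rewrite (bigD1 b) ?gc //= lerDl; apply: sumr_ge0 => b' _.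
    by rewrite exprn_ge0 // invr_ge0.
  by apply: sumr_ge0 => b _; rewrite exprn_ge0 // invr_ge0.
apply: (@le_trans _ _ (\sum_(b : bond l) 1)).
  apply: ler_sum => b _; apply: sum_is_cluster_le1; first exact: touch_sym.
  exact: card_halo_touch.
by rewrite sumr_const !card_prod card_bool card_ord mulnn.
Qed.

(** Flips in the shell, then flips in the grid. *)
Definition exit_rate : R :=
  #|shell|%:R * expR (- (2 * M) + 2 * (beta * D%:R)) +
  (l.+1 ^ 2)%:R * ((2 * l.+1 ^ 2)%:R * expR (1 - 2 * m%:R)).

Lemma phase_exit c s v : phase c s -> ~~ phase c (flip_at s v) ->
  v \in shell \/ v \in codom iota /\ rough s.
Proof.
move=> sc; have [sh gd] := phaseP _ _ sc.
have [vs|vs] := boolP (v \in shell); first by left.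
move=> nsc; right.
have sh' u : u \in shell -> flip_at s v u.
  move=> us; rewrite ffunE; case: eqVneq => [uv|_]; last exact: sh.
  by move: vs; rewrite -uv us.
have [vc|vc] := boolP (v \in codom iota); last first.
  exfalso; move/negP: nsc; apply; apply/phaseP; split=> //.
  rewrite (_ : rest _ = rest s) //; apply/funext => x; rewrite /rest ffunE.
  by case: eqVneq => // xv; move: vc; rewrite -xv codom_f.
split=> //; apply: contraT => /exists_inPn smooth.
exfalso; move/negP: nsc; apply; apply/phaseP; split=> //.
have /codomP[x vx] := vc.
rewrite (_ : rest _ = flip_site (rest s) x).
  apply: (in_phase_flip kl x mk kk _ gd).
  by move=> g gs; rewrite leqNgt; exact: smooth.
apply/funext => y; rewrite /rest /flip_site ffunE vx (inj_eq iota_inj).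
by case: eqVneq => [->|_]; rewrite ?addbT ?addbF.
Qed.

Lemma phase_flow c :
  \sum_(s | phase c s) mu s * \sum_v \sum_(r | ~~ phase c r) kernel e beta h v s r
    <= exit_rate * \sum_(s | phase c s) mu s.
Proof.
set E := expR (- (2 * M) + 2 * (beta * D%:R)).
have step s : phase c s ->
  \sum_v \sum_(r | ~~ phase c r) kernel e beta h v s r <=
  #|shell|%:R * E + (rough s)%:R * (l.+1 ^ 2)%:R.
  move=> sc.
  have bnd v : \sum_(r | ~~ phase c r) kernel e beta h v s r <=
     (v \in shell)%:R * E + (rough s)%:R * (v \in codom iota)%:R.
    apply: le_trans (kernel_exit _ _ _ _ sc) _.
    have [_|nsc] := boolP (phase c (flip_at s v)).
      by rewrite mul0r addr_ge0 // mulr_ge0 // expR_ge0.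
    rewrite mul1r; case: (phase_exit sc nsc) => [vs|[-> ->]].
      rewrite vs mul1r; apply: ler_wpDr; first by rewrite mulr_ge0.
      have [sh _] := phaseP _ _ sc.
      apply: le_trans (kernel_flip_field _ e_sym beta0 (sh _ vs) (degree v)) _.
      by rewrite ler_expR lerD2r lerN2 ler_wpM2l // field_shell.
    apply: le_trans (kernel_le1 _ _ _ _ _ _) _.
    by rewrite mulr1 lerDr mulr_ge0 // expR_ge0.
  apply: le_trans (ler_sum _ (fun v _ => bnd v)) _.
  rewrite big_split /= -mulr_suml -mulr_sumr; apply: lerD.
    rewrite ler_wpM2r ?expR_ge0 // -natr_sum ler_nat.
    by rewrite -sum1_card [X in (_ <= X)%N]big_mkcond /=; apply: leq_sum => v _; case: ifP.
  rewrite ler_wpM2l // -natr_sum ler_nat.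
  apply: (@leq_trans #|codom iota|); last first.
    by rewrite card_codom // card_prod !card_ord mulnn.
  by rewrite -sum1_card [X in (_ <= X)%N]big_mkcond /=; apply: leq_sum => v _; case: ifP.
apply: (@le_trans _ _ (\sum_(s | phase c s) mu s * (#|shell|%:R * E) +
   (\sum_(s | phase c s && rough s) mu s) * (l.+1 ^ 2)%:R)).
  rewrite [X in _ + X * _]big_mkcondr mulr_suml -big_split /=; apply: ler_sum => s sc.
  apply: le_trans (ler_wpM2l (rfim_ge0 _ _ _ _) (step s sc)) _.
  rewrite mulrDr lerD2l; case: ifP => _; first by rewrite mul1r.
  by rewrite !mul0r mulr0.
rewrite -mulr_suml /exit_rate mulrDl; apply: lerD; first by rewrite mulrC.
by rewrite mulrC -[leRHS]mulrA ler_wpM2l // peierls.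
Qed.

(** Whichever phase has mass at most 1/2 is a bottleneck. *)
Lemma trap_mixing_time (G : glauber_dynamics e beta h) (c : R) :
  4 * (c * exit_rate) <= 1 -> (c%:E <= mixing_time G)%E.
Proof.
move=> cr.
have rate0 : 0 <= exit_rate by rewrite /exit_rate !(addr_ge0, mulr_ge0, expR_ge0).
have phase_ex b : exists s, phase b s.
  exists [ffun u => if u \in codom iota then b else true]; apply/phaseP; split.
    move=> v vs; rewrite ffunE; case: ifP => // /codomP[x vx].
    by move: vs; rewrite vx (negbTE (shell_iota x)).
  rewrite (_ : rest _ = fun=> b); first exact: in_phase_const.
  by apply/funext => x; rewrite /rest ffunE codom_f.
have disj s : phase true s -> ~~ phase false s.
  move=> /phaseP[_ gt]; apply/negP => /phaseP[_ gf].
  by have := in_phase_inj gt gf.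
have total : \sum_(s | phase true s) mu s + \sum_(s | phase false s) mu s <= 1.
  rewrite -(sum_rfim e beta h) [leRHS](bigID (phase true)) /= lerD2l.
  rewrite big_mkcond [leRHS]big_mkcond; apply: ler_sum => s _.
  case: ifP => [sf|_]; last by case: ifP => // _; exact: rfim_ge0.
  by case: ifP => // /negbFE/disj; rewrite sf.
have half b : \sum_(s | phase b s) mu s <= 2^-1 -> (c%:E <= mixing_time G)%E.
  by move=> hb; apply: (mixing_bottleneck _ (phase_ex b) hb (phase_flow b)).
have [|big_true] := leP (\sum_(s | phase true s) mu s) 2^-1; first exact: half.
by apply: (half false); lra.
Qed.
End Trap.

(** * Independent attempts at a rare local event *)

Section DisjointBlocks.
Variables (d : measure_display) (T : measurableType d) (R : realType).
Variables (P : probability T R) (I : eqType) (cls : I -> set (set T)).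
Hypothesis ind : mutually_independent P cls.
Hypothesis cls_measurable : forall i, cls i `<=` measurable.
Variables (K : eqType) (F : K -> pred I) (Ev : K -> set T).
Hypothesis Ev_product : forall k, product_event cls (F k) (Ev k).
Hypothesis F_disjoint : forall k k' i, F k i -> F k' i -> k = k'.

Fixpoint none_of (ks : seq K) : set T :=
  if ks is k :: ks' then ~` Ev k `&` none_of ks' else setT.

Lemma none_of_measurable ks : measurable (none_of ks).
Proof.
elim: ks => [|k ks IH] //=; apply: measurableI => //; apply: measurableC.
exact: (product_event_measurable cls_measurable (Ev_product k)).
Qed.

(** Inclusion-exclusion on the first event, with the remainder B enlarged by
    this event in one of the two terms. *)
Lemma prb_none_of_product ks (G : pred I) B : uniq ks -> product_event cls G B ->
  (forall k i, k \in ks -> F k i -> G i -> False) ->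
  prb P (none_of ks `&` B) = \prod_(k <- ks) (1 - prb P (Ev k)) * prb P B.
Proof.
elim: ks G B => [|k ks IH] G B /=; first by move=> _ _ _; rewrite setTI big_nil mul1r.
move=> /andP[kks uks] GB disj.
have mB := product_event_measurable cls_measurable GB.
have mE := product_event_measurable cls_measurable (Ev_product k).
have [EB prEB] := product_eventI ind cls_measurable
  (fun i Fi Gi => disj k i (mem_head _ _) Fi Gi) (Ev_product k) GB.
have -> : ~` Ev k `&` none_of ks `&` B = (none_of ks `&` B) `&` ~` Ev k.
  by rewrite setIC setIA setIAC [B `&` _]setIC setIAC.
rewrite prbD //; last by apply: measurableI => //; exact: none_of_measurable.
have -> : none_of ks `&` B `&` Ev k = none_of ks `&` (Ev k `&` B).
  by rewrite -setIA [B `&` _]setIC.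
rewrite (IH G B uks GB); last by move=> j i jks; apply: disj; rewrite inE jks orbT.
rewrite (IH _ _ uks EB) ?prEB ?big_cons; first by ring.
move=> j i jks Fj /orP[Fk|]; last by apply: disj Fj; rewrite inE jks orbT.
by move: kks; rewrite (F_disjoint Fk Fj) jks.
Qed.

Lemma prb_none_of ks : uniq ks -> prb P (none_of ks) = \prod_(k <- ks) (1 - prb P (Ev k)).
Proof.
move=> uks; have T0 : product_event cls pred0 setT.
  exists [::], (fun=> setT); split=> //.
  by apply/seteqP; split=> // w _ i.
by have := prb_none_of_product uks T0; rewrite setIT prbT mulr1; apply=> k i _ _.
Qed.

End DisjointBlocks.

Lemma mutually_independent_inj (d : measure_display) (T : measurableType d) (R : realType)
  (P : probability T R) (I : eqType) (K : finType) (cls : I -> set (set T)) (f : K -> I) :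
  injective f -> mutually_independent P cls -> mutually_independent P (cls \o f).
Proof.
move=> fI ind J A uJ JA.
pose A' i := if [pick k | f k == i] is Some k then A k else setT.
have A'E k : A' (f k) = A k.
  rewrite /A'; case: pickP => [k' /eqP/fI -> //|/(_ k)]; by rewrite eqxx.
have := ind (map f J) A'; rewrite map_inj_uniq // => /(_ uJ).
rewrite big_map; under eq_bigr do rewrite A'E.
rewrite (_ : \bigcap_(i in [set` map f J]) A' i = \bigcap_(i in [set` J]) A i).
  by apply=> i /mapP[k kJ ->]; rewrite A'E; exact: JA.
apply/seteqP; split=> w wA.
  by move=> k kJ; rewrite -A'E; apply: wA; rewrite /= map_f.
by move=> _ /mapP[k kJ ->]; rewrite A'E; exact: wA.
Qed.

Section Hitting.
Variables (d : measure_display) (T : measurableType d) (R : realType).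
Variables (P : probability T R) (I : finType) (X : I -> {RV P >-> R}).
Hypothesis ind : mutually_independent P (fun i => rv_events (X i)).
Variables (N : nat) (block : 'I_N -> {set I}) (target : 'I_N -> I -> set R).
Hypothesis target_measurable : forall k i, measurable (target k i).
Hypothesis block_disjoint : forall k k' i, i \in block k -> i \in block k' -> k = k'.
Variables (q : R) (j : nat).
Hypothesis q01 : 0 <= q <= 1.
Hypothesis target_prob : forall k i, i \in block k -> q <= prb P (X i @^-1` target k i).
Hypothesis block_size : forall k, (#|block k| <= j)%N.

Let hit k : set T := [set w | forall i, i \in block k -> target k i (X i w)].

Lemma prb_some_hit (B : set T) : measurable B -> (forall k, hit k `<=` B) ->
  1 - (1 - q ^+ j) ^+ N <= prb P B.
Proof.
move=> mB hitB; pose cls i := rv_events (X i).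
have mcls i : cls i `<=` measurable by move=> A [C mC <-]; exact: measurable_funPTI.
have hitE k : hit k = \bigcap_(i in [set` enum (block k)]) (X i @^-1` target k i).
  apply/seteqP; split=> w wh i; first by rewrite /= mem_enum; exact: wh.
  by move=> ib; apply: wh; rewrite /= mem_enum.
have hit_product k : product_event cls (fun i => i \in block k) (hit k).
  exists (enum (block k)), (fun i => X i @^-1` target k i).
  split=> //; [exact: enum_uniq|by move=> i; rewrite mem_enum|].
  by move=> i _; exists (target k i).
have hit_prob k : q ^+ j <= prb P (hit k).
  rewrite hitE (independent_prb ind) ?enum_uniq //; last by move=> i _; exists (target k i).
  apply: (@le_trans _ _ (\prod_(i <- enum (block k)) q)).
    rewrite big_enum prodr_const.
    by have /andP[q0 q1] := q01; apply: ler_wiXn2l.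
  rewrite !big_enum; apply: ler_prod => i ib.
  by rewrite target_prob // andbT; have /andP[] := q01.
have mn := none_of_measurable mcls hit_product (enum 'I_N).
have sub : ~` B `<=` none_of hit (enum 'I_N).
  by move=> w nB; elim: (enum 'I_N) => //= k ks IH; split=> // hk; apply: nB; exact: hitB hk.
have prC : prb P (~` B) = 1 - prb P B.
  by rewrite -[~` B]setTI prbD // setTI prbT.
have : prb P (~` B) <= (1 - q ^+ j) ^+ N.
  apply: le_trans (prb_le P (measurableC mB) mn sub) _.
  rewrite (prb_none_of ind mcls hit_product block_disjoint) ?enum_uniq //.
  rewrite -[X in _ <= _ ^+ X](card_ord N) -prodr_const big_enum /=.
  apply: ler_prod => k _; rewrite lerD2l lerN2 hit_prob andbT subr_ge0.
  by rewrite -lee_fin -prbE ?probability_le1 //;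
    exact: (product_event_measurable mcls (hit_product k)).
by rewrite prC; lra.
Qed.
End Hitting.

(** The Gaussian density on [-K, K] is at least its value at K. *)
Lemma normal_prob_itv_ge (R : realType) (s a dl K : R) : 0 < s -> 0 <= dl ->
  - K <= a -> a + dl <= K ->
  ((dl * (normal_peak s * expR (- K ^+ 2 / (s ^+ 2 *+ 2))))%:E <=
    normal_prob 0 s `[a, (a + dl)%R]%classic)%E.
Proof.
move=> s0 dl0 aK aK'; rewrite /normal_prob.
set c := normal_peak s * _.
have c0 : 0 <= c by rewrite mulr_ge0 ?normal_peak_ge0 ?expR_ge0.
apply: (@le_trans _ _ (\int[lebesgue_measure]_(x in `[a, (a + dl)%R]%classic) (cst c%:E x))%E).
  rewrite integral_cst //= lebesgue_measure_itv /= lte_fin.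
  case: ltP => [_|]; first by rewrite -EFinB -EFinM lee_fin addrC addKr mulrC.
  by rewrite mule0 lee_fin gerDl => dl0'; rewrite mulr_le0_ge0.
apply: ge0_le_integral => //=.
  by apply/measurable_EFinP; apply: (@measurable_funS _ _ _ _ setT) => //; exact: measurable_normal_pdf.
move=> x; rewrite in_itv /= => /andP[ax xa]; rewrite lee_fin.
rewrite normal_pdfE ?gt_eqF // ler_wpM2l ?normal_peak_ge0 // ler_expR subr0.
rewrite !mulNr lerN2 ler_wpM2r //.
  by rewrite invr_ge0 mulrn_wge0 // sqr_ge0.
have : 0 <= (K - x) * (K + x) by apply: mulr_ge0; lra.
by rewrite -subr_ge0; congr (_ <= _); ring.
Qed.

(** * Disjoint squares in the box *)

Section BoxGeometry.
Variables (d n : nat).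
Implicit Types (u v : box d n).

Lemma site_inj : injective (@site d n).
Proof.
move=> x y /ffunP xy; apply/ffunP => i; apply: val_inj; have := xy i; rewrite !ffunE.
by move=> /addIr []. 
Qed.

Lemma box_adjE (x y : box d n) : box_adj x y = (\sum_(i < d) `|(x i)%:Z - (y i)%:Z| == 1).
Proof.
by rewrite /box_adj; congr (_ == _); apply: eq_bigr => i _; rewrite !ffunE opprB addrA subrK.
Qed.

Lemma box_adj_sym : symmetric (@box_adj d n).
Proof.
by move=> x y; rewrite !box_adjE; congr (_ == _); apply: eq_bigr => i _; rewrite distrC.
Qed.

Lemma box_adj_close (x y : box d n) i : box_adj x y -> (x i <= (y i).+1)%N /\ (y i <= (x i).+1)%N.
Proof.
rewrite box_adjE (bigD1 i) //= => /eqP.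
have : 0 <= \sum_(j < d | j != i) `|(x j)%:Z - (y j)%:Z| by apply: sumr_ge0.
set S := \sum_(j < d | j != i) _; move: S => S S0 h.
have : `|(x i)%:Z - (y i)%:Z| <= 1 by rewrite -h lerDl.
rewrite ler_norml; clear; lia.
Qed.

Lemma box_degree v : (#|[set u | box_adj v u]%SET| <= 3 ^ d)%N.
Proof.
pose F u : {ffun 'I_d -> 'I_3} := [ffun i => inord ((u i).+1 - v i)].
have inj : {in [set u | box_adj v u]%SET &, injective F}.
  move=> u u'; rewrite !inE => vu vu' /ffunP FF; apply/ffunP => i; apply: val_inj.
  have := FF i; rewrite !ffunE => /(congr1 val).
  have [h1 h2] := box_adj_close i vu; have [h3 h4] := box_adj_close i vu'.
  rewrite /= !inordK; move: h1 h2 h3 h4; clear; lia.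
rewrite -(card_in_imset inj); apply: leq_trans (max_card _) _.
by rewrite card_ffun !card_ord.
Qed.

Variables (i0 i1 : 'I_d) (l : nat).
Hypothesis i01 : i0 != i1.

(** The k-th square lies in the plane of the coordinates i0 and i1 through the
    centre of the box, whose coordinates are all n.  The period l + 4 along i0
    keeps the squares, with their neighbours, disjoint. *)
Definition square (k : nat) (x : grid l) : box d n :=
  [ffun i => inord (n + (if i == i0 then k * (l + 4) + x.1
                         else if i == i1 then x.2 : nat else 0))].

Definition shell k : {set box d n} :=
  [set v | (v \notin codom (square k)) && [exists x, box_adj (square k x) v]]%SET.

Definition block k : {set box d n} :=
  ([set square k x | x in [set: grid l]] :|: shell k)%SET.

Section Fit.
Variable k : nat.
Hypothesis fit : (k * (l + 4) + l <= n)%N.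

Lemma square0 x : square k x i0 = (n + (k * (l + 4) + x.1))%N :> nat.
Proof. by rewrite ffunE eqxx inordK //; have := ltn_ord x.1; lia. Qed.

Lemma square1 x : square k x i1 = (n + x.2)%N :> nat.
Proof.
by rewrite ffunE eq_sym (negbTE i01) eqxx inordK //; have := ltn_ord x.2; lia.
Qed.

Lemma square_other x i : i != i0 -> i != i1 -> square k x i = n :> nat.
Proof. by move=> h0 h1; rewrite ffunE (negbTE h0) (negbTE h1) inordK; lia. Qed.

Lemma square_inj : injective (square k).
Proof.
move=> [a b] [a' b'] /ffunP E; congr pair; apply: val_inj => /=.
  by have /(congr1 val) := E i0; rewrite /= !square0 /=; lia.
by have /(congr1 val) := E i1; rewrite /= !square1 /=; lia.
Qed.

Lemma box_adj_square x y : box_adj (square k x) (square k y) =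
  [exists b, bond_to (b, x) y || bond_to (b, y) x].
Proof.
rewrite box_adjE (bigD1 i0) // (bigD1 i1) 1?eq_sym //= big1 ?addr0; last first.
  by move=> i /andP[h0 h1]; rewrite !square_other // subrr normr0.
rewrite !square0 !square1.
have -> : [exists b, bond_to (b, x) y || bond_to (b, y) x] =
  [|| (x.1.+1 == y.1 :> nat) && (x.2 == y.2 :> nat),
      (y.1.+1 == x.1 :> nat) && (y.2 == x.2 :> nat),
      (x.1 == y.1 :> nat) && (x.2.+1 == y.2 :> nat) |
      (y.1 == x.1 :> nat) && (y.2.+1 == x.2 :> nat)].
  apply/existsP/idP => [[b]|].
    rewrite /bond_to /=; case: b => /orP[] /andP[h1 h2].
    - by apply/or4P/Or43; rewrite h2 andbT.
    - by apply/or4P/Or44; rewrite h2 andbT.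
    - by apply/or4P/Or41; rewrite h1.
    - by apply/or4P/Or42; rewrite h1.
  rewrite /bond_to; case/or4P => /andP[h1 h2].
  - by exists false; rewrite /= h1 /=; apply/orP; left.
  - by exists false; rewrite /= h1 /=; apply/orP; right.
  - by exists true; rewrite /= h2 andbT; apply/orP; left.
  - by exists true; rewrite /= h2 andbT; apply/orP; right.
move: (x.1 : nat) (x.2 : nat) (y.1 : nat) (y.2 : nat) => a b a' b'.
clear; lia.
Qed.

(** The coordinate i0 determines the square, see [block_disjoint]. *)
Lemma block_coord v : v \in block k ->
  (n + k * (l + 4) <= (v i0).+1)%N /\ (v i0 <= n + k * (l + 4) + l.+1)%N.
Proof.
rewrite inE => /orP[/imsetP[x _ ->]|].
  by rewrite square0; have := ltn_ord x.1; clear; lia.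
rewrite inE => /andP[_ /existsP[x /(box_adj_close i0)]]; rewrite square0.
by have := ltn_ord x.1; clear; lia.
Qed.

Lemma shell_square x : square k x \notin shell k.
Proof. by rewrite inE codom_f. Qed.

Lemma square_shell x v : box_adj (square k x) v -> v \notin codom (square k) -> v \in shell k.
Proof. by move=> xv vc; rewrite inE vc; apply/existsP; exists x. Qed.

Lemma card_shell : (#|shell k| <= 3 ^ d * l.+1 ^ 2)%N.
Proof.
have sub : shell k \subset (\bigcup_(x : grid l) [set u | box_adj (square k x) u])%SET.
  apply/fintype.subsetP => v; rewrite inE => /andP[_ /existsP[x xv]].
  by apply/finset.bigcupP; exists x => //; rewrite inE.
apply: leq_trans (subset_leq_card sub) _.
apply: (@leq_trans (\sum_(x : grid l) 3 ^ d)%N); last first.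
  by rewrite sum_nat_const card_prod !card_ord mulnn mulnC.
apply: (@leq_trans (\sum_(x : grid l) #|[set u | box_adj (square k x) u]%SET|)%N); last first.
  by apply: leq_sum => x _; exact: box_degree.
elim/big_rec2: _ => [|x s U _ IH]; first by rewrite cards0.
by apply: leq_trans (leq_card_setU _ _) _; rewrite leq_add2l.
Qed.

Lemma card_block : (#|block k| <= (3 ^ d).+1 * l.+1 ^ 2)%N.
Proof.
apply: leq_trans (leq_card_setU _ _) _; rewrite mulSn leq_add ?card_shell //.
by apply: leq_trans (leq_imset_card _ _) _; rewrite cardsT card_prod !card_ord mulnn.
Qed.

End Fit.

Lemma block_disjoint k k' v : (k * (l + 4) + l <= n)%N -> (k' * (l + 4) + l <= n)%N ->
  v \in block k -> v \in block k' -> k = k'.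
Proof.
move=> f f' /(block_coord f)[h1 h2] /(block_coord f')[h3 h4].
have lt a b : (a < b)%N -> (a * (l + 4) + (l + 4) <= b * (l + 4))%N.
  by move=> ab; rewrite -mulSnr leq_mul2r ab orbT.
by case: (ltngtP k k') => // /lt; move: h1 h2 h3 h4; clear; lia.
Qed.

End BoxGeometry.

(** * Probability of slow mixing in a fixed box *)

Section Environment.
Variables (R : realType) (d n : nat) (i0 i1 : 'I_d).
Hypothesis i01 : i0 != i1.
Variables (beta s : R) (disp : measure_display) (T : measurableType disp).
Variables (P : probability T R) (h : lattice d -> {RV P >-> R}).
Hypothesis h_iid : iid_centered_gaussian s h.
Hypothesis s0 : 0 < s.
Hypothesis beta_ge : 10 <= beta.
Variable G : forall w : T, glauber_dynamics (@box_adj d n) beta (fun x : box d n => h (site x) w).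
Variables (l k m N : nat) (delta M c : R).
Hypothesis mk : (18 + 324 * m <= k)%N.
Hypothesis kl : (k <= l)%N.
Hypothesis kk : (648 * k ^ 2 + 1 < l.+1 ^ 2)%N.
Hypothesis delta01 : 0 <= delta <= 1.
Hypothesis delta_small : 2 * (delta * (l.+1 ^ 2)%:R) <= 1.
Hypothesis M_ge : beta * (3 ^ d)%:R <= M.
Hypothesis fit : (N * (l + 4) + l <= n)%N.
Hypothesis c0 : 0 < c.

Definition escape_rate : R :=
  (3 ^ d * l.+1 ^ 2)%:R * expR (- (2 * M) + 2 * (beta * (3 ^ d)%:R)) +
  (l.+1 ^ 2)%:R * ((2 * l.+1 ^ 2)%:R * expR (1 - 2 * m%:R)).
Hypothesis rate_small : 4 * (c * escape_rate) <= 1.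

Notation sq j := (@square d n i0 i1 l j).
Notation blk j := (@block d n i0 i1 l j).

(** In the square, the level opposite to the force of a +1 shell. *)
Definition field_level j (v : box d n) : R :=
  if v \in codom (sq j) then
    - (beta * #|[set u | box_adj v u && (u \notin codom (sq j))]%SET|%:R) else M.

Definition target j v : set R := `[field_level j v, (field_level j v + delta)%R]%classic.

Lemma fit_j j : (j < N)%N -> (j * (l + 4) + l <= n)%N.
Proof.
move=> jN; apply: leq_trans fit; rewrite leq_add2r leq_mul2r.
by rewrite (ltnW jN) orbT.
Qed.

Lemma beta_pos : 0 <= beta. Proof. by move: beta_ge; lra. Qed.

Lemma field_level_bounds j v : - M <= field_level j v <= M.
Proof.
have M0 : 0 <= M by apply: le_trans M_ge; rewrite mulr_ge0 // beta_pos.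
rewrite /field_level; case: ifP => _; last by lra.
set D := #|_|; have DM : beta * D%:R <= M.
  apply: le_trans M_ge; rewrite ler_wpM2l ?beta_pos // ler_nat.
  apply: leq_trans (box_degree v); apply: subset_leq_card.
  by apply/fintype.subsetP => u; rewrite !inE => /andP[].
have : 0 <= beta * D%:R by rewrite mulr_ge0 // beta_pos.
lra.
Qed.

Lemma hit_mixing j w : (j < N)%N ->
  (forall v, v \in blk j -> target j v (h (site v) w)) ->
  (c%:E <= mixing_time (G w))%E.
Proof.
move=> jN hit; have fj := fit_j jN.
have M0 : 0 <= M by apply: le_trans M_ge; rewrite mulr_ge0 // beta_pos.
apply: (@trap_mixing_time R (box d n) (@box_adj d n) beta _ (@box_adj_sym d n)
  l k m (sq j) (shell n i0 i1 l j) (3 ^ d) delta M) => //.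
- exact: square_inj.
- exact: box_adj_square.
- exact: shell_square.
- exact: square_shell.
- exact: box_degree.
- move=> x; have xb : sq j x \in blk j.
    by rewrite inE; apply/orP; left; apply/imsetP; exists x.
  have := hit _ xb; rewrite /target /= in_itv /= /field_level codom_f /outer_degree.
  by move: (#|_|%:R) => D; lra.
- move=> v vs; have vb : v \in blk j by rewrite inE vs orbT.
  have := hit _ vb; rewrite /target /= in_itv /= /field_level.
  by move: vs; rewrite inE => /andP[/negbTE -> _] /andP[].
apply: le_trans rate_small; rewrite ler_wpM2l // ler_wpM2l ?(ltW c0) //.
rewrite /exit_rate /escape_rate lerD2r ler_wpM2r ?expR_ge0 // ler_nat.
exact: card_shell.
Qed.

(** A lower bound for the probability that one site has the prescribed field:
    the width of the target times the Gaussian density at [M + 1]. *)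
Definition site_prob : R :=
  delta * (normal_peak s * expR (- (M + 1) ^+ 2 / (s ^+ 2 *+ 2))).

Lemma target_prob_ge j v : site_prob <= prb P ((h (site v)) @^-1` target j v).
Proof.
have /andP[lo hi] := field_level_bounds j v; have /andP[dl0 dl1] := delta01.
rewrite -lee_fin -prbE; last by apply: measurable_funPTI; exact: measurable_itv.
have [_ /(_ (site v) (target j v) (measurable_itv _))] := h_iid.
rewrite /distribution /pushforward => ->.
apply: normal_prob_itv_ge => //; lra.
Qed.

Lemma site_prob01 : (0 < N)%N -> 0 <= site_prob <= 1.
Proof.
move=> N0; have /andP[dl0 dl1] := delta01; apply/andP; split.
  by rewrite /site_prob !mulr_ge0 ?expR_ge0 ?normal_peak_ge0.
apply: le_trans (target_prob_ge 0 [ffun=> ord0]) _.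
rewrite -lee_fin -prbE; last by apply: measurable_funPTI; exact: measurable_itv.
by apply: probability_le1; apply: measurable_funPTI; exact: measurable_itv.
Qed.

Lemma slow_mixing_prob : (0 < N)%N ->
  1 - (1 - site_prob ^+ ((3 ^ d).+1 * l.+1 ^ 2)) ^+ N <=
  prb P [set w | (c%:E <= mixing_time (G w))%E].
Proof.
move=> N0; have [ind _] := h_iid.
apply: (@prb_some_hit _ T R P (box d n) (fun v => h (site v)) _ N
   (fun j => blk j) (fun j => target j)).
- exact: (mutually_independent_inj (@site_inj d n) ind).
- by move=> j v; exact: measurable_itv.
- move=> j j' v vj vj'; apply: val_inj.
  exact: (block_disjoint i01 (fit_j (ltn_ord j)) (fit_j (ltn_ord j')) vj vj').
- exact: site_prob01.
- by move=> j v _; exact: target_prob_ge.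
- by move=> j; exact: card_block.
- by apply: measurable_mixing_time_ge => // v.
- by move=> j w; exact: hit_mixing.
Qed.

End Environment.

(** * Choice of the parameters *)

(** Room for the two scales of contours, m and 342 m: 648 * 342^2 < 10^8. *)
Definition side (m : nat) : nat := (100 * (100 * m))%N.

Lemma side_conditions m : (0 < m)%N ->
  [/\ (18 + 324 * m <= 342 * m)%N, (342 * m <= side m)%N &
      (648 * (342 * m) ^ 2 + 1 < (side m).+1 ^ 2)%N].
Proof.
move=> m0; rewrite /side; split; [lia|lia|].
by rewrite -!mulnn; lia.
Qed.

Section Estimates.
Variables (R : realType) (d : nat) (beta s : R).
Hypothesis beta0 : 0 <= beta.
Hypothesis s0 : 0 < s.

Variable A : R.
Hypothesis A1 : 1 <= A.
Hypothesis side_le : forall m, (0 < m)%N -> (side m).+1%:R <= A * m%:R.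
Let A0 : 0 <= A. Proof. by move: A1; lra. Qed.
Let D : R := (3 ^ d)%:R.

(** The fifth power beats the factor m^4 of the exit rate. *)
Lemma expR_ge_pow5 (x : R) : 0 <= x -> x ^+ 5 / (5 ^+ 5) <= expR x.
Proof.
move=> x0; rewrite -expr_div_n.
have -> : expR x = expR (x / 5) ^+ 5 by rewrite -expRM_natl mulrC divfK.
rewrite lerXn2r ?nnegrE ?expR_ge0 ?divr_ge0 //.
by apply: le_trans (expR_ge1Dx _); rewrite lerDr.
Qed.

(** Large enough to beat the force beta 3^d of the neighbours by m. *)
Definition field_size (m : nat) : R := m%:R + beta * D.

(** The exit rate is a polynomial in m times exp(- 2 m). *)
Lemma escape_rate_small : exists C : R, forall m (c : R), (0 < m)%N -> C <= m%:R ->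
  0 < c -> c <= expR m%:R ->
  4 * (c * escape_rate d beta (side m) m (field_size m)) <= 1.
Proof.
pose E := D * A ^+ 2 + 2 * A ^+ 4 * expR 1.
exists (5 ^+ 5 * (4 * E)) => m c m0 Cm c0 cm.
set x : R := m%:R in Cm cm *; have x1 : 1 <= x by rewrite ler1n.
have x0 : 0 <= x by lra.
set L : R := (side m).+1%:R; have LA : L <= A * x by exact: side_le.
have L0 : 0 <= L by [].
have L2 : L ^+ 2 <= (A * x) ^+ 2 by rewrite lerXn2r ?nnegrE // mulr_ge0.
have x24 : x ^+ 2 <= x ^+ 4 by rewrite ler_weXn2l.
have rate : escape_rate d beta (side m) m (field_size m) <= expR (- (2 * x)) * (x ^+ 4 * E).
  have LL : ((side m).+1 ^ 2)%:R = L ^+ 2 :> R by rewrite natrX.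
  rewrite /escape_rate /field_size -/x (natrM _ (3 ^ d)) (natrM _ 2) !LL -/D.
  rewrite (_ : - (2 * (x + beta * D)) + _ = - (2 * x)); last by ring.
  rewrite (_ : 1 - 2 * x = - (2 * x) + 1); last by ring.
  rewrite expRD /E.
  set u := expR (- (2 * x)); have u0 : 0 <= u by exact: expR_ge0.
  have h1 : D * L ^+ 2 <= x ^+ 4 * (D * A ^+ 2).
    rewrite [leRHS]mulrCA ler_wpM2l //.
    by apply: (le_trans L2); rewrite exprMn mulrC ler_wpM2r ?sqr_ge0.
  have h2 : L ^+ 2 * (2 * L ^+ 2) <= x ^+ 4 * (2 * A ^+ 4).
    have -> : x ^+ 4 * (2 * A ^+ 4) = (A * x) ^+ 2 * (2 * (A * x) ^+ 2) by ring.
    apply: ler_pM; [exact: sqr_ge0| |exact: L2|].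
      by apply: mulr_ge0 => //; exact: sqr_ge0.
    by apply: ler_wpM2l => //; exact: L2.
  have -> : D * L ^+ 2 * u + L ^+ 2 * (2 * L ^+ 2 * (u * expR 1)) =
     u * (D * L ^+ 2 + L ^+ 2 * (2 * L ^+ 2) * expR 1) by ring.
  rewrite ler_wpM2l // mulrDr [x ^+ 4 * (_ * expR 1)]mulrA lerD //.
  by rewrite ler_wpM2r ?expR_ge0.
have E0 : 0 <= E.
  apply: addr_ge0; apply: mulr_ge0; rewrite ?exprn_ge0 ?expR_ge0 //.
  by apply: mulr_ge0; rewrite ?exprn_ge0.
have xE : 4 * (x ^+ 4 * E) <= expR x.
  apply: le_trans (expR_ge_pow5 x0); rewrite ler_pdivlMr ?exprn_gt0 //.
  rewrite (_ : 4 * _ * _ = x ^+ 4 * (5 ^+ 5 * (4 * E))); last by ring.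
  by rewrite [leRHS]exprSr ler_wpM2l // exprn_ge0.
apply: (@le_trans _ _ (4 * (expR x * (expR (- (2 * x)) * (x ^+ 4 * E))))).
  rewrite ler_wpM2l // ler_pM ?(ltW c0) //.
  by rewrite /escape_rate !(addr_ge0, mulr_ge0, expR_ge0).
have ex : expR x * expR (- (2 * x)) = expR (- x) by rewrite -expRD; congr expR; ring.
have -> : 4 * (expR x * (expR (- (2 * x)) * (x ^+ 4 * E))) =
  4 * (x ^+ 4 * E) * (expR x * expR (- (2 * x))) by ring.
by rewrite ex expRN ler_pdivrMr ?expR_gt0 // mul1r.
Qed.

Definition field_width (m : nat) : R := (2 * (side m).+1%:R ^+ 2)^-1.

(** Each of the O(m^2) sites of a block has the prescribed field with
    probability at least exp(- B m^2): the density contributes exp(- O(m^2))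
    and the width of the target is of order 1 / m^2. *)
Lemma site_prob_ge : exists2 C : R, 0 <= C & forall m, (0 < m)%N ->
  expR (- (C * m%:R ^+ 4)) <=
  site_prob s (field_width m) (field_size m) ^+ ((3 ^ d).+1 * (side m).+1 ^ 2).
Proof.
pose B := 2 * A ^+ 2 + `|ln (normal_peak s)| + (2 + beta * D) ^+ 2 / (s ^+ 2 *+ 2).
have B0 : 0 <= B.
  apply: addr_ge0; last by rewrite divr_ge0 ?mulrn_wge0 ?sqr_ge0.
  by apply: addr_ge0 => //; apply: mulr_ge0 => //; exact: sqr_ge0.
exists (B * ((D + 1) * A ^+ 2)).
  by apply: mulr_ge0 => //; apply: mulr_ge0; rewrite ?sqr_ge0 ?addr_ge0.
move=> m m0.
set x : R := m%:R; have x1 : 1 <= x by rewrite ler1n.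
set L : R := (side m).+1%:R; have LA : L <= A * x by exact: side_le.
have L0 : 0 < L by rewrite ltr0n.
have L2 : L ^+ 2 <= A ^+ 2 * x ^+ 2.
  by rewrite -exprMn lerXn2r ?nnegrE ?(ltW L0) // mulr_ge0.
have x2 : 1 <= x ^+ 2 by rewrite expr_ge1 //; lra.
have q_ge : expR (- (B * x ^+ 2)) <= site_prob s (field_width m) (field_size m).
  pose K := (2 + beta * D) ^+ 2 / (s ^+ 2 *+ 2).
  have -> : expR (- (B * x ^+ 2)) = expR (- (2 * A ^+ 2 * x ^+ 2)) *
      (expR (- (`|ln (normal_peak s)| * x ^+ 2)) * expR (- (K * x ^+ 2))).
    by rewrite -!expRD; congr expR; rewrite /B -/K; ring.
  rewrite /site_prob /field_width -/L.
  apply: ler_pM; rewrite ?mulr_ge0 ?expR_ge0 //.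
    rewrite expRN lef_pV2 ?posrE ?expR_gt0 ?mulr_gt0 ?exprn_gt0 //.
    apply: (@le_trans _ _ (2 * A ^+ 2 * x ^+ 2)); first by rewrite -mulrA ler_wpM2l.
    by apply: le_trans (expR_ge1Dx _); rewrite lerDr.
  apply: ler_pM; rewrite ?expR_ge0 //.
    rewrite -[leRHS]lnK ?posrE ?normal_peak_gt0 ?gt_eqF // ler_expR.
    set a := ln _; have : `|a| <= `|a| * x ^+ 2 by rewrite ler_peMr.
    by have := lerNnormlW (lexx `|a|); lra.
  have bD : 0 <= beta * D by rewrite mulr_ge0.
  have M0 : 0 <= field_size m + 1 by rewrite /field_size !addr_ge0.
  have Mx : field_size m + 1 <= (2 + beta * D) * x.
    by rewrite /field_size -/x; have := ler_peMr bD x1; lra.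
  have Mx0 : 0 <= (2 + beta * D) * x by rewrite mulr_ge0 // addr_ge0.
  rewrite ler_expR mulNr lerN2 /K [leRHS]mulrAC ler_wpM2r //.
    by rewrite invr_ge0 mulrn_wge0 // sqr_ge0.
  by rewrite -exprMn lerXn2r ?nnegrE.
apply: (@le_trans _ _ (expR (- (B * x ^+ 2)) ^+ ((3 ^ d).+1 * (side m).+1 ^ 2))).
  rewrite -[leRHS]expRM_natl ler_expR mulrN lerN2 natrM natrX -/L.
  rewrite (_ : B * _ * x ^+ 4 = (D + 1) * (A ^+ 2 * x ^+ 2) * (B * x ^+ 2)); last by ring.
  have Bx0 : 0 <= B * x ^+ 2 by apply: mulr_ge0 => //; exact: sqr_ge0.
  apply: ler_wpM2r => //.
  by rewrite -natr1 ler_wpM2l // addr_ge0.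
by rewrite lerXn2r ?nnegrE ?expR_ge0 // (le_trans (expR_ge0 _) q_ge).
Qed.

(** m times the inverse of the probability of success of one square: then all
    of them fail with probability at most exp(- m) ([no_hit_le]). *)
Definition nsquares (C : R) (m : nat) : nat := (Num.truncn (m%:R * expR (C * m%:R ^+ 4))).+1.

Lemma nsquares_fit (C : R) : 0 <= C -> exists C' : R, forall m n : nat,
  (0 < m)%N -> (0 < n)%N -> C' * m%:R ^+ 4 <= ln n%:R ->
  (nsquares C m * (side m + 4) + side m <= n)%N.
Proof.
move=> C0.
(* 9 A absorbs the polynomial factors in m *)
exists (C + 9 * A) => m n m0 n0 mn.
set x : R := m%:R in mn *; have x1 : 1 <= x by rewrite ler1n.
have x0 : 0 <= x by lra.
have LA := side_le m0; rewrite -/x in LA.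
have Ax : 1 <= A * x by rewrite -[1]mulr1 ler_pM //; lra.
pose y := expR (C * x ^+ 4).
have y1 : 1 <= y by rewrite /y -expR0 ler_expR mulr_ge0 // exprn_ge0.
have N_le : (nsquares C m)%:R <= 2 * (x * y) :> R.
  rewrite /nsquares -/x -/y -natr1.
  have : (Num.truncn (x * y))%:R <= x * y by rewrite truncn_le // mulr_ge0 //; lra.
  have : 1 <= x * y by rewrite -[1]mulr1 ler_pM.
  lra.
rewrite -(ler_nat R) natrD natrM natrD.
have l_le : (side m)%:R <= A * x by apply: le_trans LA; rewrite ler_nat.
apply: (@le_trans _ _ (2 * (x * y) * (4 * (A * x)) + A * x)).
  apply: lerD => //; apply: ler_pM => //.
  have -> : 4 * (A * x) = A * x + 3 * (A * x) by ring.
  by move: LA; rewrite -natr1; lra.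
apply: (@le_trans _ _ (9 * A * x ^+ 2 * y)).
  have : A * x <= A * x ^+ 2 * y.
    rewrite -mulrA; apply: ler_wpM2l => //; apply: (@le_trans _ _ (x ^+ 2)).
      by rewrite expr2 ler_peMl.
    by rewrite ler_peMr // sqr_ge0.
  have : 2 * (x * y) * (4 * (A * x)) = 8 * (A * x ^+ 2 * y) by ring.
  lra.
apply: (@le_trans _ _ (expR ((C + 9 * A) * x ^+ 4))).
  have -> : expR ((C + 9 * A) * x ^+ 4) = expR (9 * A * x ^+ 4) * y.
    by rewrite /y -expRD; congr expR; ring.
  apply: ler_wpM2r; first exact: expR_ge0.
  apply: (@le_trans _ _ (9 * A * x ^+ 4)).
    by apply: ler_wpM2l; [rewrite mulr_ge0 | exact: ler_weXn2l].
  by apply: le_trans (expR_ge1Dx _); rewrite lerDr.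
by rewrite -[leRHS]lnK ?posrE ?ltr0n // ler_expR.
Qed.

Lemma no_hit_le (q : R) (C : R) m (j : nat) : (0 < m)%N ->
  expR (- (C * m%:R ^+ 4)) <= q ^+ j -> q ^+ j <= 1 ->
  (1 - q ^+ j) ^+ nsquares C m <= expR (- m%:R).
Proof.
move=> m0; set Q := q ^+ j; set y := C * m%:R ^+ 4 => yQ Q1.
apply: (@le_trans _ _ (expR (- Q) ^+ nsquares C m)).
  rewrite lerXn2r ?nnegrE ?expR_ge0 ?subr_ge0 //; exact: expR_ge1Dx.
rewrite -expRM_natl ler_expR mulrN lerN2.
have N_ge : m%:R * expR y <= (nsquares C m)%:R by rewrite ltW // /nsquares truncnS_gt.
have -> : m%:R = m%:R * expR y * expR (- y) :> R.
  by rewrite -mulrA -expRD subrr expR0 mulr1.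
by apply: ler_pM => //; rewrite ?mulr_ge0 ?expR_ge0.
Qed.

End Estimates.

(** * Asymptotics *)

Section Scale.
Variables (R : realType) (d : nat).
Hypothesis d2 : (2 <= d)%N.

Definition exponent : R := (d%:R - 1) / (4 * d%:R).
Definition side_scale (n : nat) : nat := (Num.truncn ((ln n%:R : R) `^ exponent)).+1.

Let dR : (2 : R) <= d%:R. Proof. by rewrite ler_nat. Qed.

Lemma exponent_gt0 : 0 < exponent.
Proof. by rewrite divr_gt0 ?mulr_gt0 //; move: dR; lra. Qed.

Lemma side_scale_gt n : (ln n%:R : R) `^ exponent < (side_scale n)%:R.
Proof. exact: truncnS_gt. Qed.

Lemma near_ln_ge (Y : R) : \forall n \near \oo, Y <= ln n%:R.
Proof.
exists (Num.truncn (expR Y)).+1 => // n /= Yn.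
have Yn' : expR Y <= n%:R.
  by apply/ltW/(lt_le_trans (truncnS_gt _)); rewrite ler_nat.
by rewrite -[Y]expRK ler_ln ?posrE ?expR_gt0 // (lt_le_trans (expR_gt0 Y)).
Qed.

Lemma near_side_scale_ge (C : R) : \forall n \near \oo, C <= (side_scale n)%:R.
Proof.
near=> n; apply: le_trans (ltW (side_scale_gt n)).
have a0 := exponent_gt0.
apply: (@le_trans _ _ ((`|C| `^ exponent^-1) `^ exponent)).
  by rewrite -powRrM mulVf ?gt_eqF // powRr1 // ler_norm.
apply: ge0_ler_powR; rewrite ?nnegrE ?powR_ge0 ?(ltW a0) //.
  by apply: le_trans (powR_ge0 _ _) _; near: n; exact: near_ln_ge.
by near: n; exact: near_ln_ge.
Unshelve. all: by end_near. Qed.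

(** With y = ln n, the fourth power of y^a is y^(1 - 1/d), which is o(y). *)
Lemma side_scale_pow4 (C : R) n : 1 <= ln n%:R :> R -> (16 * `|C|) ^+ d <= ln n%:R ->
  C * (side_scale n)%:R ^+ 4 <= ln n%:R.
Proof.
set y : R := ln n%:R => y1 yC.
have y0 : 0 < y by lra.
pose x := y `^ exponent; pose z := y `^ (d%:R^-1).
have a0 := exponent_gt0.
have d0 : (d%:R : R) != 0 by rewrite gt_eqF //; move: dR; lra.
have zd : z ^+ d = y by rewrite /z -powR_mulrn ?powR_ge0 // -powRrM mulVf // powRr1 // ltW.
have xz : x ^+ 4 * z = y.
  rewrite /x /z -powR_mulrn ?powR_ge0 // -powRrM -powRD; last first.
    by rewrite (gt_eqF y0) implybT.
  rewrite (_ : _ + _ = 1) ?powRr1 ?(ltW y0) // /exponent.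
  by field; rewrite d0.
have Cz : 16 * `|C| <= z.
  rewrite -(@ler_pXn2r _ d) ?nnegrE ?powR_ge0 ?mulr_ge0 //; last exact: ltnW.
  by rewrite zd.
have x1 : 1 <= x.
  have p1 : 1 `^ exponent = 1 :> R by rewrite powR1.
  rewrite /x -[leLHS]p1; apply: ge0_ler_powR; rewrite ?nnegrE ?(ltW a0) //.
  exact: ltW.
have mx : (side_scale n)%:R <= 2 * x.
  rewrite /side_scale -/y -/x -natr1.
  have : (Num.truncn x)%:R <= x by rewrite truncn_le //; lra.
  by move: x1; lra.
have x40 : 0 <= x ^+ 4 by rewrite exprn_ge0 //; lra.
apply: (@le_trans _ _ (`|C| * (2 * x) ^+ 4)).
  apply: (@le_trans _ _ (`|C| * (side_scale n)%:R ^+ 4)).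
    by rewrite ler_wpM2r ?exprn_ge0 // ler_norm.
  by rewrite ler_wpM2l // lerXn2r ?nnegrE //; lra.
have -> : `|C| * (2 * x) ^+ 4 = x ^+ 4 * (16 * `|C|) by ring.
by rewrite -xz ler_wpM2l.
Qed.

Lemma near_side_scale_pow4 (C : R) : \forall n \near \oo, C * (side_scale n)%:R ^+ 4 <= ln n%:R.
Proof.
near=> n; apply: side_scale_pow4; near: n; exact: near_ln_ge.
Unshelve. all: by end_near. Qed.

End Scale.

Theorem proposition6p1 (R : realType) (d : nat) (hd : (2 <= d)%N) :
  exists beta0 : R, forall beta : R, beta0 <= beta -> forall s : R, 0 < s ->
  forall (disp : measure_display) (T : measurableType disp)
    (P : probability T R) (h : lattice d -> {RV P >-> R}),
  iid_centered_gaussian s h ->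
  forall G : forall (n : nat) (w : T),
    glauber_dynamics (@box_adj d n) beta (fun x : box d n => h (site x) w),
  (fun n : nat => P [set w : T |
     ((expR ((ln n%:R) `^ ((d%:R - 1) / (4 * d%:R))))%:E
        <= mixing_time (G n w))%E]) @ \oo --> 1%E.
Proof.
exists 10 => beta beta_ge s s0 disp T P h h_iid G.
have beta0 : 0 <= beta by lra.
pose A : R := 101 * 101.
have A1 : 1 <= A by rewrite /A; lra.
have sideA m : (0 < m)%N -> (side m).+1%:R <= A * m%:R.
  by move=> m0; rewrite /A -[101]/(101%:R) -!natrM ler_nat /side; lia.
have [C1 rateC] := escape_rate_small d beta A1 sideA.
have [C2 C20 probC] := site_prob_ge d beta0 s0 A1 sideA.
have [C3 fitC] := nsquares_fit A1 sideA C20.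
pose i0 : 'I_d := Ordinal (ltnW hd); pose i1 : 'I_d := Ordinal hd.
have i01 : i0 != i1 by [].
pose x n : R := (ln n%:R) `^ ((d%:R - 1) / (4 * d%:R)).
pose E n := [set w : T | ((expR (x n))%:E <= mixing_time (G n w))%E].
have mE n : measurable (E n).
  by apply: measurable_mixing_time_ge => //; exact: expR_gt0.
have slow n : (0 < n)%N -> C1 <= (side_scale R d n)%:R ->
    C3 * (side_scale R d n)%:R ^+ 4 <= ln n%:R -> 1 - expR (- (side_scale R d n)%:R) <= prb P (E n).
  move=> n0; set m := side_scale R d n => mC1 mC3.
  have m0 : (0 < m)%N by [].
  have [mk kl kk] := side_conditions m0.
  have width01 : 0 <= field_width R m <= 1.
    rewrite /field_width invr_ge0 mulr_ge0 ?exprn_ge0 //= invf_le1 ?mulr_gt0 ?exprn_gt0 //.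
    have : 1 <= (side m).+1%:R ^+ 2 :> R by rewrite exprn_ege1 // ler1n.
    lra.
  have width_small : 2 * (field_width R m * ((side m).+1 ^ 2)%:R) <= 1.
    by rewrite natrX mulrCA /field_width mulVf // mulf_neq0 ?expf_neq0.
  have fit := fitC m n m0 n0 mC3.
  have size_ge : beta * (3 ^ d)%:R <= field_size d beta m by rewrite /field_size lerDr.
  have rate : 4 * (expR (x n) * escape_rate d beta (side m) m (field_size d beta m)) <= 1.
    apply: rateC => //; first exact: expR_gt0.
    by rewrite ler_expR ltW // side_scale_gt.
  have := slow_mixing_prob i01 h_iid s0 beta_ge (G n) mk kl kk width01 width_small
    size_ge fit (expR_gt0 _) rate (ltn0Sn _).
  apply: le_trans; rewrite lerD2l lerN2.
  apply: no_hit_le => //; first exact: probC.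
  have /andP[q0 q1] := site_prob01 n i0 i1 h_iid s0 beta_ge (side m) width01 size_ge
    (ltn0Sn 0).
  exact: exprn_ile1.
rewrite (_ : (fun n => _) = EFin \o (fun n => prb P (E n))); last first.
  by apply/funext => n; rewrite -[LHS]/(P (E n)) (prbE P (mE n)).
apply: cvg_EFin; first by near=> n.
apply/cvgrPdist_le => eps eps0; near=> n.
have le1 : prb P (E n) <= 1 by rewrite -lee_fin -prbE // probability_le1.
rewrite /= ger0_norm ?subr_ge0 // lerBlDr -lerBlDl.
apply: le_trans (slow n _ _ _); last 1 first.
- by near: n; exact: near_side_scale_pow4.
- rewrite lerD2l lerN2 expRN -[leRHS]invrK lef_pV2 ?posrE ?expR_gt0 ?invr_gt0 //.
  apply: (@le_trans _ _ (side_scale R d n)%:R); first by near: n; exact: near_side_scale_ge.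
  by apply: le_trans (expR_ge1Dx _); rewrite lerDr.
- by near: n; exists 1%N.
- by near: n; exact: near_side_scale_ge.
Unshelve. all: by end_near. Qed.
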